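(* Let $\mathcal T$ be the endofunctor of the category $\widehat{\mathbb G}$ of globular sets for which an $n$-cell of $\mathcal TX$ is a pair $(p,f:p\to X)$ with $p\in\mathrm{Tr}_n$, with $s(p,f)=(\partial p,f\sigma_p)$, $t(p,f)=(\partial p,f\tau_p)$ and $\mathcal T(h)(p,f)=(p,hf)$. Let $\eta:1\to\mathcal T$ and $\mu:\mathcal T^2\to\mathcal T$ be given by $$x\in X_n\mapsto(n,x:n\to X),\qquad(p\in\mathrm{Tr}_n,\;f:p\to\mathcal TX)\mapsto(q_f,h_f),$$ with $q_f\in\mathrm{Tr}_n$ and $h_f:q_f\to X$ as defined in the context. Then $(\mathcal T,\eta,\mu)$ is a p.r.a monad.
   Context: **Globular sets.** $\widehat{\mathbb G}$ is the category of globular sets: sets $X_n$ ($n\in\mathbb N$) of $n$-cells with maps $s,t:X_{n+1}\to X_n$ satisfying $ss=st$, $ts=tt$. For $0$-cells $a,b$ of $X$, the hom $X(a,b)$ is the globular set whose $n$-cells are the $(n+1)$-cells of $X$ with iterated $0$-dimensional source $a$ and target $b$. A map $f:X\to Z$ is the same thing as a function $f_0:X_0\to Z_0$ with maps $X(a,b)\to Z(f_0a,f_0b)$. A finite sequence $(X_1,\dots,X_k)$ of globular sets is regarded as a globular set with $0$-cells $\{0,\dots,k\}$, homs $(X_1,\dots,X_k)(i-1,i)=X_i$, all other homs empty. **Trees.** $\mathrm{Tr}_0=\{0\}$ and $\mathrm{Tr}_{n+1}$ is the set of finite sequences $(p_1,\dots,p_k)$, $k\ge0$, of elements of $\mathrm{Tr}_n$.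 Each $p\in\mathrm{Tr}_n$ also denotes a globular set: $0$ has one $0$-cell and no other cells; $(p_1,\dots,p_k)$ is the sequence regarded as a globular set. Maps $\partial:\mathrm{Tr}_{n+1}\to\mathrm{Tr}_n$ and $\sigma_p,\tau_p:\partial p\to p$: for $p\in\mathrm{Tr}_1$, $\partial p=0$ and $\sigma_p,\tau_p$ select the least and greatest $0$-cell of $p$; for $p=(p_1,\dots,p_k)\in\mathrm{Tr}_{n+2}$, $\partial p=(\partial p_1,\dots,\partial p_k)$ and $\sigma_p,\tau_p$ are identities on $0$-cells and $\sigma_{p_i},\tau_{p_i}$ on homs. **Unit.** Regard $n\in\mathbb N$ as an element of $\mathrm{Tr}_n$, inductively by $0=0$ and $n+1=(n)$; the corresponding globular set has exactly one $n$-cell and represents $X\mapsto X_n$, so $x\in X_n$ corresponds to a map $x:n\to X$. **Multiplication.** $\{\mathcal TX\}_0=X_0$, and an $n$-cell of $\{\mathcal TX\}(a,b)$ is the same as a sequence $a=x_0,\dots,x_m=b$ of $0$-cells of $X$ with an $n$-cell of $\prod_{j}\mathcal T(X(x_{j-1},x_j))$. Since the globular set $p_i$ is connected, for $p=(p_1,\dots,p_k)\in\mathrm{Tr}_{n+1}$ a map $f:p\to\mathcal TX$ amounts to $0$-cells $x_0$ and $x_{ij}$ of $X$ ($1\le i\le k$, $1\le j\le m_i$, ordered lexicographically after $x_0$; $x_0=f(0)$ and the hom map $p_i\to\{\mathcal TX\}(f(i-1),f(i))$ factors through the summand given by the sequence from $f(i-1)$ to $f(i)$ with subsequent terms $x_{i1},\dots,x_{im_i}$)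 together with maps $f_{ij}:p_i\to\mathcal T(X(x_{(ij)-1},x_{ij}))$, where $(ij)-1$ denotes the predecessor. Define $q_f,h_f$ inductively: if $p=0$ and $f$ picks out $x\in X_0$, then $q_f=0$ and $h_f=x:0\to X$; if $p\in\mathrm{Tr}_{n+1}$, then $q_f=(q_{f_{ij}}:1\le i\le k,1\le j\le m_i)$ in lexicographic order, and $h_f$ has $0$-cell map $0\mapsto x_0$, $(i,j)\mapsto x_{ij}$ and hom maps $h_{f_{ij}}$. **P.r.a monad.** A functor $F:\mathcal A\to\mathcal B$ is p.r.a (a parametric right adjoint) if for every $A\in\mathcal A$ the functor $\mathcal A/A\to\mathcal B/FA$ induced by $F$ has a left adjoint. A monad is p.r.a when its functor part is p.r.a and its unit and multiplication are cartesian (all naturality squares are pullbacks). *)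

(* Defs.v *)
From mathcomp Require Import all_boot all_order.
From mathcomp Require Import boolp.

Set Implicit Arguments.
Unset Strict Implicit.
Unset Printing Implicit Defensive.

Record category := Category {
  ob :> Type;
  hom : ob -> ob -> Type;
  idm : forall a, hom a a;
  compm : forall a b c, hom b c -> hom a b -> hom a c;
  comp1m : forall a b (f : hom a b), compm (idm b) f = f;
  compm1 : forall a b (f : hom a b), compm f (idm a) = f;
  compA : forall a b c d (h : hom c d) (g : hom b c) (f : hom a b),
    compm h (compm g f) = compm (compm h g) f }.

Arguments hom {_} a b.
Arguments idm {_} a.
Arguments compm {_ a b c} g f.

Record functor (C D : category) := Functor {
  fob :> C -> D;
  fmap : forall a b : C, hom a b -> hom (fob a) (fob b);
  fmap1 : forall a : C, fmap (idm a) = idm (fob a);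
  fmapM : forall (a b c : C) (g : hom b c) (f : hom a b),
    fmap (compm g f) = compm (fmap g) (fmap f) }.

Arguments fmap {C D} F {a b} f : rename.

Definition functor_id (C : category) : functor C C :=
  @Functor C C (fun a => a) (fun _ _ f => f)
    (fun _ => erefl) (fun _ _ _ _ _ => erefl).

Lemma functor_comp1 (C D E : category) (G : functor D E) (F : functor C D)
  (a : C) : fmap G (fmap F (idm a)) = idm (G (F a)).
Proof. by rewrite !fmap1. Qed.

Lemma functor_compM (C D E : category) (G : functor D E) (F : functor C D)
  (a b c : C) (g : hom b c) (f : hom a b) :
  fmap G (fmap F (compm g f)) = compm (fmap G (fmap F g)) (fmap G (fmap F f)).
Proof. by rewrite !fmapM. Qed.

Definition functor_comp (C D E : category) (G : functor D E)
    (F : functor C D) : functor C E :=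
  @Functor C E (fun a => G (F a)) (fun _ _ f => fmap G (fmap F f))
    (functor_comp1 G F) (@functor_compM C D E G F).

Record nat_trans (C D : category) (F G : functor C D) := NatTrans {
  ncomp :> forall a : C, hom (F a) (G a);
  natural : forall (a b : C) (f : hom a b),
    compm (fmap G f) (ncomp a) = compm (ncomp b) (fmap F f) }.

Definition has_left_adjoint (C D : category) (R : functor C D) : Prop :=
  exists (L : functor D C)
         (unit : nat_trans (functor_id D) (functor_comp R L))
         (counit : nat_trans (functor_comp L R) (functor_id C)),
    (forall d : D, compm (counit (L d)) (fmap L (unit d)) = idm (L d)) /\
    (forall c : C, compm (fmap R (counit c)) (unit (R c)) = idm (R c)).

Record slice_ob (C : category) (A : C) := SliceOb {
  sdom : C;
  sarr : hom sdom A }.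

Arguments SliceOb {C A} sdom sarr.

Record slice_hom (C : category) (A : C) (x y : slice_ob A) := SliceHom {
  stop :> hom (sdom x) (sdom y);
  stri : compm (sarr y) stop = sarr x }.

Lemma slice_hom_eq (C : category) (A : C) (x y : slice_ob A)
  (f g : slice_hom x y) : stop f = stop g -> f = g.
Proof.
by case: f g => [f ef] [g eg] /= E; subst g; rewrite (Prop_irrelevance ef eg).
Qed.

Lemma slice_id_subproof (C : category) (A : C) (x : slice_ob A) :
  compm (sarr x) (idm (sdom x)) = sarr x.
Proof. exact: compm1. Qed.

Lemma slice_comp_subproof (C : category) (A : C) (x y z : slice_ob A)
  (g : slice_hom y z) (f : slice_hom x y) :
  compm (sarr z) (compm g f) = sarr x.
Proof. by rewrite compA (stri g) (stri f). Qed.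

Definition slice_id (C : category) (A : C) (x : slice_ob A) : slice_hom x x :=
  SliceHom (slice_id_subproof x).

Definition slice_comp (C : category) (A : C) (x y z : slice_ob A)
    (g : slice_hom y z) (f : slice_hom x y) : slice_hom x z :=
  SliceHom (slice_comp_subproof g f).

Lemma slice_comp1m (C : category) (A : C) (x y : slice_ob A)
  (f : slice_hom x y) : slice_comp (slice_id y) f = f.
Proof. by apply: slice_hom_eq; exact: comp1m. Qed.

Lemma slice_compm1 (C : category) (A : C) (x y : slice_ob A)
  (f : slice_hom x y) : slice_comp f (slice_id x) = f.
Proof. by apply: slice_hom_eq; exact: compm1. Qed.

Lemma slice_compA (C : category) (A : C) (x y z t : slice_ob A)
  (h : slice_hom z t) (g : slice_hom y z) (f : slice_hom x y) :
  slice_comp h (slice_comp g f) = slice_comp (slice_comp h g) f.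
Proof. by apply: slice_hom_eq; exact: compA. Qed.

Definition slice (C : category) (A : C) : category :=
  Category (@slice_comp1m C A) (@slice_compm1 C A) (@slice_compA C A).

Definition slice_fob (C D : category) (F : functor C D) (A : C)
    (x : slice A) : slice (F A) := SliceOb (F (sdom x)) (fmap F (sarr x)).

Lemma slice_fmap_subproof (C D : category) (F : functor C D) (A : C)
  (x y : slice A) (f : slice_hom x y) :
  compm (fmap F (sarr y)) (fmap F f) = fmap F (sarr x).
Proof. by rewrite -fmapM (stri f). Qed.

Definition slice_fmap (C D : category) (F : functor C D) (A : C)
    (x y : slice A) (f : hom x y) : hom (slice_fob F x) (slice_fob F y) :=
  @SliceHom D (F A) (slice_fob F x) (slice_fob F y) _ (slice_fmap_subproof F f).

Lemma slice_fmap1 (C D : category) (F : functor C D) (A : C) (x : slice A) :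
  slice_fmap F (idm x) = idm (slice_fob F x).
Proof. by apply: slice_hom_eq; exact: fmap1. Qed.

Lemma slice_fmapM (C D : category) (F : functor C D) (A : C)
  (x y z : slice A) (g : hom y z) (f : hom x y) :
  slice_fmap F (compm g f) = compm (slice_fmap F g) (slice_fmap F f).
Proof. by apply: slice_hom_eq; exact: fmapM. Qed.

Definition slice_functor (C D : category) (F : functor C D) (A : C) :
    functor (slice A) (slice (F A)) :=
  Functor (@slice_fmap1 C D F A) (@slice_fmapM C D F A).

Definition pra (C D : category) (F : functor C D) : Prop :=
  forall A : C, has_left_adjoint (slice_functor F A).

Definition is_pullback (C : category) (P a b c : C)
    (p : hom P a) (q : hom P b) (f : hom a c) (g : hom b c) : Prop :=
  compm f p = compm g q /\
  forall (Q : C) (u : hom Q a) (v : hom Q b), compm f u = compm g v ->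
    exists! w : hom Q P, compm p w = u /\ compm q w = v.

Definition cartesian (C D : category) (F G : functor C D)
    (al : nat_trans F G) : Prop :=
  forall (a b : C) (f : hom a b),
    is_pullback (al a) (fmap F f) (fmap G f) (al b).

Definition is_monad (C : category) (T : functor C C)
    (eta : nat_trans (functor_id C) T)
    (mu : nat_trans (functor_comp T T) T) : Prop :=
  [/\ forall a : C, compm (mu a) (eta (T a)) = idm (T a),
      forall a : C, compm (mu a) (fmap T (eta a)) = idm (T a)
    & forall a : C, compm (mu a) (mu (T a)) = compm (mu a) (fmap T (mu a))].

Definition is_pra_monad (C : category) (T : functor C C)
    (eta : nat_trans (functor_id C) T)
    (mu : nat_trans (functor_comp T T) T) : Prop :=
  [/\ is_monad eta mu, pra T, cartesian eta & cartesian mu].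

Record gset := GSet {
  cell :> nat -> Type;
  src : forall n, cell n.+1 -> cell n;
  tgt : forall n, cell n.+1 -> cell n;
  src_src : forall n (x : cell n.+2), src (src x) = src (tgt x);
  tgt_src : forall n (x : cell n.+2), tgt (src x) = tgt (tgt x) }.

Arguments src {_ n} x : rename.
Arguments tgt {_ n} x : rename.

Record gmap (X Y : gset) := GMap {
  gfun :> forall n, X n -> Y n;
  gsrc : forall n (x : X n.+1), gfun (src x) = src (gfun x);
  gtgt : forall n (x : X n.+1), gfun (tgt x) = tgt (gfun x) }.

Arguments gfun {X Y} f {n} x : rename.

Lemma gmap_eq (X Y : gset) (f g : gmap X Y) :
  (forall n (x : X n), f n x = g n x) -> f = g.
Proof.
case: f g => [f fs ft] [g gs gt] /= E.
have E' : f = g.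
  by apply: functional_extensionality_dep => n;
     apply: functional_extensionality_dep => x; exact: E.
subst g; by rewrite (Prop_irrelevance fs gs) (Prop_irrelevance ft gt).
Qed.

Definition gid (X : gset) : gmap X X :=
  @GMap X X (fun _ x => x) (fun _ _ => erefl) (fun _ _ => erefl).

Lemma gcomp_src (X Y Z : gset) (g : gmap Y Z) (f : gmap X Y) n (x : X n.+1) :
  g n (f n (src x)) = src (g n.+1 (f n.+1 x)).
Proof. by rewrite !gsrc. Qed.

Lemma gcomp_tgt (X Y Z : gset) (g : gmap Y Z) (f : gmap X Y) n (x : X n.+1) :
  g n (f n (tgt x)) = tgt (g n.+1 (f n.+1 x)).
Proof. by rewrite !gtgt. Qed.

Definition gcomp (X Y Z : gset) (g : gmap Y Z) (f : gmap X Y) : gmap X Z :=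
  @GMap X Z (fun n x => g n (f n x)) (gcomp_src g f) (gcomp_tgt g f).

Lemma gcomp1m (X Y : gset) (f : gmap X Y) : gcomp (gid Y) f = f.
Proof. exact: gmap_eq. Qed.

Lemma gcompm1 (X Y : gset) (f : gmap X Y) : gcomp f (gid X) = f.
Proof. exact: gmap_eq. Qed.

Lemma gcompA (X Y Z W : gset) (h : gmap Z W) (g : gmap Y Z) (f : gmap X Y) :
  gcomp h (gcomp g f) = gcomp (gcomp h g) f.
Proof. exact: gmap_eq. Qed.

Definition Glob : category := Category gcomp1m gcompm1 gcompA.

Fixpoint src0 (X : gset) n : X n.+1 -> X 0 :=
  if n is n'.+1 then fun x => src0 (src x) else fun x => src x.

Fixpoint tgt0 (X : gset) n : X n.+1 -> X 0 :=
  if n is n'.+1 then fun x => tgt0 (tgt x) else fun x => tgt x.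

Lemma src0_tgt (X : gset) n (x : X n.+2) : src0 (tgt x) = src0 x.
Proof. by case: n x => [|n] x /=; rewrite src_src. Qed.

Lemma tgt0_src (X : gset) n (x : X n.+2) : tgt0 (src x) = tgt0 x.
Proof. by case: n x => [|n] x /=; rewrite tgt_src. Qed.

Lemma src0_gmap (X Y : gset) (f : gmap X Y) n (x : X n.+1) :
  src0 (f n.+1 x) = f 0 (src0 x).
Proof. by elim: n x => [|n IH] x /=; rewrite -gsrc. Qed.

Lemma tgt0_gmap (X Y : gset) (f : gmap X Y) n (x : X n.+1) :
  tgt0 (f n.+1 x) = f 0 (tgt0 x).
Proof. by elim: n x => [|n IH] x /=; rewrite -gtgt. Qed.

Definition hom_cell (X : gset) (a b : X 0) n : Type :=
  {x : X n.+1 | src0 x = a /\ tgt0 x = b}.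

Lemma hom_cell_eq (X : gset) (a b : X 0) n (x y : hom_cell a b n) :
  sval x = sval y -> x = y.
Proof. by case: x y => x px [y py] /= E; exact: eq_exist. Qed.

Lemma hom_src_subproof (X : gset) (a b : X 0) n (x : X n.+2) :
  src0 x = a /\ tgt0 x = b -> src0 (src x) = a /\ tgt0 (src x) = b.
Proof. by rewrite tgt0_src. Qed.

Lemma hom_tgt_subproof (X : gset) (a b : X 0) n (x : X n.+2) :
  src0 x = a /\ tgt0 x = b -> src0 (tgt x) = a /\ tgt0 (tgt x) = b.
Proof. by rewrite src0_tgt. Qed.

Definition hom_src (X : gset) (a b : X 0) n (x : hom_cell a b n.+1) :
    hom_cell a b n :=
  exist _ (src (sval x)) (hom_src_subproof (svalP x)).

Definition hom_tgt (X : gset) (a b : X 0) n (x : hom_cell a b n.+1) :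
    hom_cell a b n :=
  exist _ (tgt (sval x)) (hom_tgt_subproof (svalP x)).

Lemma hom_src_src (X : gset) (a b : X 0) n (x : hom_cell a b n.+2) :
  hom_src (hom_src x) = hom_src (hom_tgt x).
Proof. by apply: hom_cell_eq; exact: src_src. Qed.

Lemma hom_tgt_src (X : gset) (a b : X 0) n (x : hom_cell a b n.+2) :
  hom_tgt (hom_src x) = hom_tgt (hom_tgt x).
Proof. by apply: hom_cell_eq; exact: tgt_src. Qed.

Definition ghom (X : gset) (a b : X 0) : gset :=
  GSet (@hom_src_src X a b) (@hom_tgt_src X a b).

Lemma gmap_hom_subproof (X Y : gset) (f : gmap X Y) (a b : X 0) n
  (x : X n.+1) : src0 x = a /\ tgt0 x = b ->
  src0 (f n.+1 x) = f 0 a /\ tgt0 (f n.+1 x) = f 0 b.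
Proof. by rewrite src0_gmap tgt0_gmap => -[-> ->]. Qed.

Definition gmap_hom_fun (X Y : gset) (f : gmap X Y) (a b : X 0) n
    (x : ghom a b n) : ghom (f 0 a) (f 0 b) n :=
  exist _ (f n.+1 (sval x)) (gmap_hom_subproof f (svalP x)).

Lemma gmap_hom_src (X Y : gset) (f : gmap X Y) (a b : X 0) n
  (x : ghom a b n.+1) : gmap_hom_fun f (src x) = src (gmap_hom_fun f x).
Proof. by apply: hom_cell_eq; exact: gsrc. Qed.

Lemma gmap_hom_tgt (X Y : gset) (f : gmap X Y) (a b : X 0) n
  (x : ghom a b n.+1) : gmap_hom_fun f (tgt x) = tgt (gmap_hom_fun f x).
Proof. by apply: hom_cell_eq; exact: gtgt. Qed.

(* The hom map  X(a,b) -> Y(fa,fb)  of f. *)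
Definition gmap_hom (X Y : gset) (f : gmap X Y) (a b : X 0) :
    gmap (ghom a b) (ghom (f 0 a) (f 0 b)) :=
  GMap (@gmap_hom_src X Y f a b) (@gmap_hom_tgt X Y f a b).

Lemma hom_cast_subproof (X : gset) (a b a' b' : X 0) n (x : X n.+1) :
  a = a' -> b = b' ->
  src0 x = a /\ tgt0 x = b -> src0 x = a' /\ tgt0 x = b'.
Proof. by move=> <- <-. Qed.

Definition hom_cast_fun (X : gset) (a b a' b' : X 0) (ea : a = a')
    (eb : b = b') n (x : ghom a b n) : ghom a' b' n :=
  exist _ (sval x) (hom_cast_subproof ea eb (svalP x)).

Lemma hom_cast_src (X : gset) (a b a' b' : X 0) (ea : a = a') (eb : b = b')
  n (x : ghom a b n.+1) :
  hom_cast_fun ea eb (src x) = src (hom_cast_fun ea eb x).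
Proof. exact: hom_cell_eq. Qed.

Lemma hom_cast_tgt (X : gset) (a b a' b' : X 0) (ea : a = a') (eb : b = b')
  n (x : ghom a b n.+1) :
  hom_cast_fun ea eb (tgt x) = tgt (hom_cast_fun ea eb x).
Proof. exact: hom_cell_eq. Qed.

(* Rewriting the endpoints of a hom; the underlying cells are unchanged. *)
Definition hom_cast (X : gset) (a b a' b' : X 0) (ea : a = a') (eb : b = b') :
    gmap (ghom a b) (ghom a' b') :=
  GMap (@hom_cast_src X a b a' b' ea eb) (@hom_cast_tgt X a b a' b' ea eb).

Lemma gprod_src_src (I : Type) (X : I -> gset) n (x : forall i, X i n.+2) :
  (fun i => src (src (x i))) = (fun i => src (tgt (x i))).
Proof. by apply: functional_extensionality_dep => i; exact: src_src. Qed.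

Lemma gprod_tgt_src (I : Type) (X : I -> gset) n (x : forall i, X i n.+2) :
  (fun i => tgt (src (x i))) = (fun i => tgt (tgt (x i))).
Proof. by apply: functional_extensionality_dep => i; exact: tgt_src. Qed.

Definition gprod (I : Type) (X : I -> gset) : gset :=
  @GSet (fun n => forall i, X i n) (fun n x i => src (x i))
    (fun n x i => tgt (x i)) (@gprod_src_src I X) (@gprod_tgt_src I X).

Definition gproj (I : Type) (X : I -> gset) (i : I) : gmap (gprod X) (X i) :=
  @GMap (gprod X) (X i) (fun n x => x i) (fun _ _ => erefl) (fun _ _ => erefl).

Definition point_cell (n : nat) : Type :=
  if n is 0 then unit else Empty_set.

Definition point_face n (x : point_cell n.+1) : point_cell n :=
  match x with end.

Definition gpoint : gset :=
  @GSet point_cell point_face point_face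
    (fun n x => match x with end) (fun n x => match x with end).

Definition point_map_fun (X : gset) (x : X 0) n : gpoint n -> X n :=
  match n with 0 => fun _ => x | n'.+1 => fun c => match c with end end.

Definition point_map (X : gset) (x : X 0) : gmap gpoint X :=
  @GMap gpoint X (point_map_fun x)
    (fun n c => match c with end) (fun n c => match c with end).

(* In the sequence (X_1,...,X_k), the index  i : 'I_k  stands for  i + 1 ;
   its endpoints are  lend i = i  and  rend i = i + 1  in {0,...,k}.        *)
Definition lend k (i : 'I_k) : 'I_k.+1 := widen_ord (leqnSn k) i.
Definition rend k (i : 'I_k) : 'I_k.+1 := lift ord0 i.

Definition seq_cell k (X : 'I_k -> gset) (n : nat) : Type :=
  if n is n'.+1 then {i : 'I_k & X i n'} else 'I_k.+1.

Definition seq_src k (X : 'I_k -> gset) n :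
    seq_cell X n.+1 -> seq_cell X n :=
  match n with
  | 0 => fun x => lend (tag x)
  | n'.+1 => fun x => Tagged (fun i => X i n') (src (tagged x))
  end.

Definition seq_tgt k (X : 'I_k -> gset) n :
    seq_cell X n.+1 -> seq_cell X n :=
  match n with
  | 0 => fun x => rend (tag x)
  | n'.+1 => fun x => Tagged (fun i => X i n') (tgt (tagged x))
  end.

Lemma seq_src_src k (X : 'I_k -> gset) n (x : seq_cell X n.+2) :
  seq_src (seq_src x) = seq_src (seq_tgt x).
Proof. by case: n x => [|n] [i x] //=; rewrite src_src. Qed.

Lemma seq_tgt_src k (X : 'I_k -> gset) n (x : seq_cell X n.+2) :
  seq_tgt (seq_src x) = seq_tgt (seq_tgt x).
Proof. by case: n x => [|n] [i x] //=; rewrite tgt_src. Qed.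

Definition gseq k (X : 'I_k -> gset) : gset :=
  GSet (@seq_src_src k X) (@seq_tgt_src k X).

Lemma gseq_incl_subproof k (X : 'I_k -> gset) (i : 'I_k) n (x : X i n) :
  src0 (X := gseq X) (n := n) (existT _ i x) = lend i /\
  tgt0 (X := gseq X) (n := n) (existT _ i x) = rend i.
Proof. by elim: n x => [|n IH] x //=; split; [case: (IH (src x)) | case: (IH (tgt x))]. Qed.

Definition gseq_incl_fun k (X : 'I_k -> gset) (i : 'I_k) n (x : X i n) :
    ghom (X := gseq X) (lend i) (rend i) n :=
  exist _ (existT _ i x) (gseq_incl_subproof x).

Lemma gseq_incl_src k (X : 'I_k -> gset) (i : 'I_k) n (x : X i n.+1) :
  gseq_incl_fun (src x) = src (gseq_incl_fun x).
Proof. exact: hom_cell_eq. Qed.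

Lemma gseq_incl_tgt k (X : 'I_k -> gset) (i : 'I_k) n (x : X i n.+1) :
  gseq_incl_fun (tgt x) = tgt (gseq_incl_fun x).
Proof. exact: hom_cell_eq. Qed.

(* The identification  X_i = (X_1,...,X_k)(i-1,i). *)
Definition gseq_incl k (X : 'I_k -> gset) (i : 'I_k) :
    gmap (X i) (ghom (X := gseq X) (lend i) (rend i)) :=
  GMap (@gseq_incl_src k X i) (@gseq_incl_tgt k X i).

(* The hom maps  X_i -> Z(f(i-1),f(i))  of  f : (X_1,...,X_k) -> Z. *)
Definition gseq_homs k (X : 'I_k -> gset) (Z : gset) (f : gmap (gseq X) Z)
    (i : 'I_k) : gmap (X i) (ghom (f 0 (lend i)) (f 0 (rend i))) :=
  gcomp (gmap_hom f (lend i) (rend i)) (gseq_incl X i).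

(* The map  (X_1,...,X_k) -> Z  with given 0-cell map and hom maps. *)
Definition gseq_map_fun k (X : 'I_k -> gset) (Z : gset) (f0 : 'I_k.+1 -> Z 0)
    (f : forall i, gmap (X i) (ghom (f0 (lend i)) (f0 (rend i)))) n :
    gseq X n -> Z n :=
  match n with
  | 0 => f0
  | n'.+1 => fun x => sval (f (tag x) n' (tagged x))
  end.

Lemma gseq_map_src k (X : 'I_k -> gset) (Z : gset) (f0 : 'I_k.+1 -> Z 0)
  (f : forall i, gmap (X i) (ghom (f0 (lend i)) (f0 (rend i)))) n
  (x : gseq X n.+1) : gseq_map_fun f (src x) = src (gseq_map_fun f x).
Proof.
case: n x => [|n] [i x] /=; first by case: (svalP (f i 0 x)).
by rewrite gsrc.
Qed.

Lemma gseq_map_tgt k (X : 'I_k -> gset) (Z : gset) (f0 : 'I_k.+1 -> Z 0)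
  (f : forall i, gmap (X i) (ghom (f0 (lend i)) (f0 (rend i)))) n
  (x : gseq X n.+1) : gseq_map_fun f (tgt x) = tgt (gseq_map_fun f x).
Proof.
case: n x => [|n] [i x] /=; first by case: (svalP (f i 0 x)).
by rewrite gtgt.
Qed.

Definition gseq_map k (X : 'I_k -> gset) (Z : gset) (f0 : 'I_k.+1 -> Z 0)
    (f : forall i, gmap (X i) (ghom (f0 (lend i)) (f0 (rend i)))) :
    gmap (gseq X) Z :=
  GMap (gseq_map_src f) (gseq_map_tgt f).

(* The map  (X_1,...,X_k) -> (Y_1,...,Y_k)  that is the identity on 0-cells
   and  f_i : X_i -> Y_i  on homs.                                          *)
Definition gseq_id0 k (X Y : 'I_k -> gset) (f : forall i, gmap (X i) (Y i)) :
    gmap (gseq X) (gseq Y) :=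
  @gseq_map k X (gseq Y) (fun i => i) (fun i => gcomp (gseq_incl Y i) (f i)).

(* Finite sequences are families on ['I_k], so that mapping a function over
   a sequence preserves its length definitionally.                          *)
Record fseq (A : Type) := FSeq { flen : nat; fnth : 'I_flen -> A }.

Arguments FSeq {A} flen fnth.
Arguments fnth {A} s i : rename.

Definition fseq_map (A B : Type) (f : A -> B) (s : fseq A) : fseq B :=
  FSeq (flen s) (fun i => f (fnth s i)).

Fixpoint Tr (n : nat) : Type := if n is n'.+1 then fseq (Tr n') else unit.

Fixpoint tree n : Tr n -> gset :=
  if n is n'.+1 then fun p => gseq (fun i => tree (fnth p i))
  else fun _ => gpoint.

Fixpoint bd n : Tr n.+1 -> Tr n :=
  if n is n'.+1 then fun p => fseq_map (@bd n') p else fun _ => tt.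

Fixpoint sigma n : forall p : Tr n.+1, gmap (tree (bd p)) (tree p) :=
  match n with
  | 0 => fun p => @point_map (tree (n := 1) p) ord0
  | n'.+1 => fun p => gseq_id0 (fun i => sigma (fnth p i))
  end.

Fixpoint tau n : forall p : Tr n.+1, gmap (tree (bd p)) (tree p) :=
  match n with
  | 0 => fun p => @point_map (tree (n := 1) p) ord_max
  | n'.+1 => fun p => gseq_id0 (fun i => tau (fnth p i))
  end.

Lemma sigma_sigma n (p : Tr n.+2) :
  gcomp (sigma p) (sigma (bd p)) = gcomp (tau p) (sigma (bd p)).
Proof.
elim: n p => [|n IH] p; apply: gmap_eq => -[|m] //= [i x] /=.
have /(congr1 (fun f : gmap _ _ => f m x)) /= E := IH (fnth p i).
by congr (existT _ i _).
Qed.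

Lemma sigma_tau n (p : Tr n.+2) :
  gcomp (sigma p) (tau (bd p)) = gcomp (tau p) (tau (bd p)).
Proof.
elim: n p => [|n IH] p; apply: gmap_eq => -[|m] //= [i x] /=.
have /(congr1 (fun f : gmap _ _ => f m x)) /= E := IH (fnth p i).
by congr (existT _ i _).
Qed.

Definition T_cell (X : gset) (n : nat) : Type :=
  {p : Tr n & gmap (tree p) X}.

Definition T_src (X : gset) n (c : T_cell X n.+1) : T_cell X n :=
  existT _ (bd (tag c)) (gcomp (tagged c) (sigma (tag c))).

Definition T_tgt (X : gset) n (c : T_cell X n.+1) : T_cell X n :=
  existT _ (bd (tag c)) (gcomp (tagged c) (tau (tag c))).

Lemma T_src_src (X : gset) n (c : T_cell X n.+2) :
  T_src (T_src c) = T_src (T_tgt c).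
Proof.
case: c => p f; congr (existT _ _ _) => /=.
by rewrite -!gcompA sigma_sigma.
Qed.

Lemma T_tgt_src (X : gset) n (c : T_cell X n.+2) :
  T_tgt (T_src c) = T_tgt (T_tgt c).
Proof.
case: c => p f; congr (existT _ _ _) => /=.
by rewrite -!gcompA sigma_tau.
Qed.

Definition T_ob (X : gset) : gset := GSet (@T_src_src X) (@T_tgt_src X).

Definition T_map_fun (X Y : gset) (h : gmap X Y) n (c : T_ob X n) : T_ob Y n :=
  existT _ (tag c) (gcomp h (tagged c)).

Lemma T_map_src (X Y : gset) (h : gmap X Y) n (c : T_ob X n.+1) :
  T_map_fun h (src c) = src (T_map_fun h c).
Proof. by congr (existT _ _ _); rewrite /= gcompA. Qed.

Lemma T_map_tgt (X Y : gset) (h : gmap X Y) n (c : T_ob X n.+1) :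
  T_map_fun h (tgt c) = tgt (T_map_fun h c).
Proof. by congr (existT _ _ _); rewrite /= gcompA. Qed.

Definition T_map (X Y : gset) (h : gmap X Y) : gmap (T_ob X) (T_ob Y) :=
  GMap (T_map_src h) (T_map_tgt h).

Lemma T_map1 (X : gset) : T_map (gid X) = gid (T_ob X).
Proof.
by apply: gmap_eq => n [p f]; rewrite /= /T_map_fun /= gcomp1m.
Qed.

Lemma T_mapM (X Y Z : gset) (g : gmap Y Z) (f : gmap X Y) :
  T_map (gcomp g f) = gcomp (T_map g) (T_map f).
Proof.
by apply: gmap_eq => n [p h]; rewrite /= /T_map_fun /= gcompA.
Qed.

Definition Tfun : functor Glob Glob :=
  @Functor Glob Glob T_ob T_map T_map1 T_mapM.

Fixpoint globe (n : nat) : Tr n :=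
  match n with 0 => tt | n'.+1 => FSeq 1 (fun _ => globe n') end.

Fixpoint globe_top (n : nat) : tree (globe n) n :=
  match n with
  | 0 => tt
  | n'.+1 => existT (fun i : 'I_1 => tree (globe n') n') ord0 (globe_top n')
  end.

Definition globe_ends (X : gset) n (x : X n.+1) (i : 'I_2) : X 0 :=
  if i == ord0 then src0 x else tgt0 x.

Lemma globe_prev (X : gset) n (x : X n.+1) (i : 'I_1) :
  src0 x = globe_ends x (lend i).
Proof. by rewrite ord1. Qed.

Lemma globe_next (X : gset) n (x : X n.+1) (i : 'I_1) :
  tgt0 x = globe_ends x (rend i).
Proof. by rewrite ord1. Qed.

(* The map  x : n -> X  corresponding to  x \in X_n ; see [globe_mapP]. *)
Fixpoint globe_map n : forall X : gset, X n -> gmap (tree (globe n)) X :=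
  match n with
  | 0 => fun X x => point_map x
  | n'.+1 => fun X x =>
      @gseq_map 1 (fun _ => tree (globe n')) X (globe_ends x)
        (fun i => gcomp (hom_cast (globe_prev x i) (globe_next x i))
           (@globe_map n' (ghom (src0 x) (tgt0 x))
              (exist _ x (conj erefl erefl))))
  end.

Lemma globe_map_top n (X : gset) (x : X n) : globe_map x n (globe_top n) = x.
Proof. by elim: n X x => [|n IH] X x //=; rewrite IH. Qed.

Lemma globe_mapP n (X : gset) (f : gmap (tree (globe n)) X) (x : X n) :
  f n (globe_top n) = x -> f = globe_map x.
Proof.
move=> <- {x}; elim: n X f => [|n IH] X f.
  by apply: gmap_eq => -[|m] [].
have e0 : src0 (f n.+1 (globe_top n.+1)) = f 0 ord0.
  rewrite src0_gmap /=; congr (f 0 _).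
  have [-> _] := gseq_incl_subproof
    (X := fun _ : 'I_1 => tree (globe n)) (i := ord0) (globe_top n).
  exact: val_inj.
have e1 : tgt0 (f n.+1 (globe_top n.+1)) = f 0 ord_max.
  rewrite tgt0_gmap /=; congr (f 0 _).
  have [_ ->] := gseq_incl_subproof
    (X := fun _ : 'I_1 => tree (globe n)) (i := ord0) (globe_top n).
  exact: val_inj.
apply: gmap_eq => -[|m] /= x.
  rewrite /globe_ends; case: eqP => [->|ne]; first by rewrite e0.
  rewrite e1; congr (f 0 _); apply: val_inj.
  by case: x ne => -[|[|x]] //= lt []; apply: val_inj.
case: x => i x /=.
have l0 : lend (ord0 : 'I_1) = ord0 by exact: val_inj.
have r0 : rend (ord0 : 'I_1) = ord_max by exact: val_inj.
have h0 : f 0 (lend ord0) = src0 (f n.+1 (globe_top n.+1)) by rewrite e0 l0.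
have h1 : f 0 (rend ord0) = tgt0 (f n.+1 (globe_top n.+1)) by rewrite e1 r0.
pose g := gcomp (hom_cast h0 h1) (gseq_homs f ord0).
have gE : g n (globe_top n) =
    exist _ (f n.+1 (globe_top n.+1)) (conj erefl erefl).
  exact: hom_cell_eq.
have := IH _ g; rewrite gE [i]ord1 => E.
exact: (congr1 (fun h : gmap (tree (globe n)) (ghom (src0 (f n.+1 _)) _) =>
  sval (h m x)) E).
Qed.

(* A sequence  x_0,...,x_m  (m >= 0). *)
Record chain (A : Type) := Chain { clen : nat; cnth : 'I_clen.+1 -> A }.

Arguments Chain {A} clen cnth.
Arguments cnth {A} c i : rename.

(* The identification  (TX)_0 = X_0. *)
Definition vertex (X : gset) (c : T_ob X 0) : X 0 :=
  (tagged c : gmap (tree (n := 0) (tag c)) X) 0 tt.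

(* An (n+1)-cell of TX is a sequence  x_0,...,x_m  together with an n-cell of
   the product of the  T(X(x_{j-1},x_j)).                                    *)
Definition spine (X : gset) n (c : T_ob X n.+1) : chain (X 0) :=
  Chain (flen (tag c)) (fun j => tagged c 0 j).

Definition summand (X : gset) (w : chain (X 0)) : gset :=
  gprod (fun j : 'I_(clen w) =>
    T_ob (ghom (cnth w (lend j)) (cnth w (rend j)))).

Definition component (X : gset) n (c : T_ob X n.+1) : summand (spine c) n :=
  fun j => existT _ (fnth (tag c) j)
    (@gseq_homs _ (fun i => tree (fnth (tag c) i)) X (tagged c) j).

Arguments component {X n} c.

Lemma component_src (X : gset) n (c : T_ob X n.+2) :
  component (src c) = src (component c).
Proof.
apply: functional_extensionality_dep => j; congr (existT _ _ _).
by apply: gmap_eq => m x; exact: hom_cell_eq.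
Qed.

Lemma component_tgt (X : gset) n (c : T_ob X n.+2) :
  component (tgt c) = tgt (component c).
Proof.
apply: functional_extensionality_dep => j; congr (existT _ _ _).
by apply: gmap_eq => m x; exact: hom_cell_eq.
Qed.

Definition root n : forall p : Tr n, tree p 0 :=
  match n with 0 => fun _ => tt | n'.+1 => fun _ => ord0 end.

Lemma tree_connected n (p : Tr n) (W : Type) (phi : forall m, tree p m -> W) :
  (forall m (c : tree p m.+1), phi m (src c) = phi m.+1 c) ->
  (forall m (c : tree p m.+1), phi m (tgt c) = phi m.+1 c) ->
  forall m (c : tree p m), phi m c = phi 0 (root p).
Proof.
move=> hs ht; have h0 c : phi 0 c = phi 0 (root p).
  case: n p phi hs ht c => [|n] p phi hs ht /=; first by case.
  case=> j; elim: j => [|j IH] lt; first by congr (phi 0 _); exact: val_inj.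
  pose i : 'I_(flen p) := Ordinal (lt : j < flen p).
  have := ht 0 (existT _ i (root (fnth p i))).
  rewrite -hs /= (_ : Ordinal lt = rend i); last exact: val_inj.
  move=> ->; rewrite -(IH (ltnW lt)); congr (phi 0 _); exact: val_inj.
by elim=> [|m IH] c //; rewrite -hs.
Qed.

(* For  u : p -> {TX}(a,b) , the sequence indexing the summand through which
   u  factors, and the components  p -> T(X(x_{j-1},x_j))  of the factorization. *)
Definition trunk n (p : Tr n) (X : gset) (a b : T_ob X 0)
    (u : gmap (tree p) (ghom a b)) : chain (X 0) :=
  spine (sval (u 0 (root p))).

Lemma spine_trunk n (p : Tr n) (X : gset) (a b : T_ob X 0)
  (u : gmap (tree p) (ghom a b)) m (c : tree p m) :
  spine (sval (u m c)) = trunk u.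
Proof.
by apply: (tree_connected (phi := fun m c => spine (sval (u m c)))) => {}m {}c;
  rewrite ?gsrc ?gtgt.
Qed.

Definition factor_fun n (p : Tr n) (X : gset) (a b : T_ob X 0)
    (u : gmap (tree p) (ghom a b)) m (c : tree p m) : summand (trunk u) m :=
  eq_rect _ (fun w => summand w m) (component (sval (u m c))) _
    (spine_trunk u c).

Arguments factor_fun {n p X a b} u {m} c.

Lemma summand_cast_src (X : gset) (w w' : chain (X 0)) (e e' : w = w') m
  (c : summand w m.+1) :
  eq_rect _ (fun v => summand v m) (src c) _ e' =
  src (eq_rect _ (fun v => summand v m.+1) c _ e).
Proof. by subst w'; rewrite (Prop_irrelevance e' erefl). Qed.

Lemma summand_cast_tgt (X : gset) (w w' : chain (X 0)) (e e' : w = w') m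
  (c : summand w m.+1) :
  eq_rect _ (fun v => summand v m) (tgt c) _ e' =
  tgt (eq_rect _ (fun v => summand v m.+1) c _ e).
Proof. by subst w'; rewrite (Prop_irrelevance e' erefl). Qed.

Lemma factor_src n (p : Tr n) (X : gset) (a b : T_ob X 0)
  (u : gmap (tree p) (ghom a b)) m (c : tree p m.+1) :
  factor_fun u (src c) = src (factor_fun u c).
Proof.
rewrite /factor_fun; move: (spine_trunk u (src c)); rewrite gsrc => e.
apply: etrans _ (summand_cast_src (spine_trunk u c) e _).
by rewrite -component_src.
Qed.

Lemma factor_tgt n (p : Tr n) (X : gset) (a b : T_ob X 0)
  (u : gmap (tree p) (ghom a b)) m (c : tree p m.+1) :
  factor_fun u (tgt c) = tgt (factor_fun u c).
Proof.
rewrite /factor_fun; move: (spine_trunk u (tgt c)); rewrite gtgt => e.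
apply: etrans _ (summand_cast_tgt (spine_trunk u c) e _).
by rewrite -component_tgt.
Qed.

Definition factor n (p : Tr n) (X : gset) (a b : T_ob X 0)
    (u : gmap (tree p) (ghom a b)) : gmap (tree p) (summand (trunk u)) :=
  GMap (factor_src u) (factor_tgt u).

Lemma trunk_first n (p : Tr n) (X : gset) (a b : T_ob X 0)
  (u : gmap (tree p) (ghom a b)) : cnth (trunk u) ord0 = vertex a.
Proof. by case: (svalP (u 0 (root p))) => /(congr1 (@vertex X)). Qed.

Lemma trunk_last n (p : Tr n) (X : gset) (a b : T_ob X 0)
  (u : gmap (tree p) (ghom a b)) : cnth (trunk u) ord_max = vertex b.
Proof. by case: (svalP (u 0 (root p))) => _ /(congr1 (@vertex X)). Qed.

(* Lexicographic concatenation: [tagnat.sig1] and [tagnat.sig2] are the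
   components of the increasing bijection from  {0 < ... < sum_i m_i - 1}  to
   the pairs  (i,j)  in lexicographic order.                                *)
Definition lex_concat k (A : Type) (m : 'I_k -> nat)
    (q : forall i, 'I_(m i) -> A) : fseq A :=
  FSeq (\sum_i m i) (fun l => q (tagnat.sig1 l) (tagnat.sig2 l)).

(* The sequence  x_0, x_11, ..., x_1m_1, ..., x_k1, ..., x_km_k. *)
Definition lex_chain k (A : Type) (x0 : A) (w : 'I_k -> chain A)
    (l : 'I_(\sum_i clen (w i)).+1) : A :=
  if unlift ord0 l is Some l' then
    cnth (w (tagnat.sig1 l')) (rend (tagnat.sig2 l'))
  else x0.

Lemma lex_chain_rend k (A : Type) (x0 : A) (w : 'I_k -> chain A)
  (l : 'I_(\sum_i clen (w i))) :
  cnth (w (tagnat.sig1 l)) (rend (tagnat.sig2 l)) = lex_chain x0 (rend l).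
Proof. by rewrite /lex_chain liftK. Qed.

Lemma lex_chain_rank k (A : Type) (x0 : A) (w : 'I_k -> chain A) (i : 'I_k)
  (j : 'I_(clen (w i))) :
  lex_chain x0 (rend (tagnat.Rank (p_ := fun i => clen (w i)) i j)) =
  cnth (w i) (rend j).
Proof.
rewrite -lex_chain_rend.
exact: (congr1 (fun s : {i & 'I_(clen (w i))} =>
  cnth (w (tag s)) (rend (tagged s))) (tagnat.rankK (Tagged _ j))).
Qed.

Lemma lex_chain_start k (A : Type) (y : 'I_k.+1 -> A) (w : 'I_k -> chain A) :
  (forall i, cnth (w i) ord0 = y (lend i)) ->
  (forall i, cnth (w i) ord_max = y (rend i)) ->
  forall (i : 'I_k.+1) (a : 'I_(\sum_i clen (w i)).+1),
    a = \sum_(j < k | j < i) clen (w j) :> nat -> lex_chain (y ord0) a = y i.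
Proof.
move=> hl hr [i lti]; elim: i lti => [|i IH] lti a /=.
  move=> a0; have -> : a = ord0.
    by apply: val_inj; rewrite /= a0; exact: big_pred0.
  by rewrite /lex_chain unlift_none; congr y; exact: val_inj.
pose i' : 'I_k := Ordinal (lti : i < k).
have -> : Ordinal lti = rend i' by exact: val_inj.
have -> : \sum_(j < k | j < i.+1) clen (w j) =
    clen (w i') + \sum_(j < k | j < i) clen (w j).
  rewrite (bigD1 i') //=; congr (_ + _); apply: eq_bigl => j.
  by rewrite ltnS -val_eqE /= [RHS]ltn_neqAle andbC.
rewrite -hr; case: (posnP (clen (w i'))) => [c0|cpos].
  rewrite {1}c0 add0n => ea; rewrite (IH (ltnW lti)) //.
  have -> : Ordinal (ltnW lti) = lend i' by exact: val_inj.
  by rewrite -hl; congr cnth; apply: val_inj; rewrite /= c0.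
have ltm : (clen (w i')).-1 < clen (w i') by rewrite prednK.
move=> ea; pose m := Ordinal ltm.
have -> : a = rend (tagnat.Rank (p_ := fun i => clen (w i)) i' m).
  apply: ord_inj; rewrite /rend lift0; apply: (etrans ea).
  by rewrite tagnat.RankEsum /= -addnS prednK // addnC.
rewrite lex_chain_rank; congr cnth.
by apply: val_inj; rewrite /= /bump /= add1n prednK.
Qed.

(* If  x_i0, ..., x_im_i  runs from  y_{i-1}  to  y_i , then the predecessor of
   x_ij  in the lexicographic chain is  x_i(j-1) , also for  j = 1 .          *)
Lemma lex_chain_lend k (A : Type) (y : 'I_k.+1 -> A) (w : 'I_k -> chain A) :
  (forall i, cnth (w i) ord0 = y (lend i)) ->
  (forall i, cnth (w i) ord_max = y (rend i)) ->
  forall l : 'I_(\sum_i clen (w i)),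
    cnth (w (tagnat.sig1 l)) (lend (tagnat.sig2 l)) =
    lex_chain (y ord0) (lend l).
Proof.
move=> hl hr l; have := tagnat.rect l.
move: (tagnat.sig1 l) (tagnat.sig2 l) => i [[|j] ltj] /= el.
  rewrite (lex_chain_start hl hr (i := lend i)) /=; last by rewrite el addn0.
  by rewrite -hl; congr cnth; exact: val_inj.
have -> : lend l =
    rend (tagnat.Rank (p_ := fun i => clen (w i)) i (Ordinal (ltnW ltj))).
  by apply: ord_inj; rewrite /rend lift0 tagnat.RankEsum -addnS.
by rewrite lex_chain_rank; congr cnth; exact: val_inj.
Qed.

Lemma mult_lend n k (p : 'I_k -> Tr n) (X : gset)
  (f : gmap (gseq (fun i => tree (p i))) (T_ob X))
  (l : 'I_(\sum_i clen (trunk (gseq_homs f i)))) :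
  cnth (trunk (gseq_homs f (tagnat.sig1 l))) (lend (tagnat.sig2 l)) =
  lex_chain (vertex (f 0 ord0)) (lend l).
Proof.
by apply: (@lex_chain_lend _ _ (fun i => vertex (f 0 i))) => i;
  [exact: trunk_first | exact: trunk_last].
Qed.

(* The pair (q_f, h_f). *)
Fixpoint mult n : forall (X : gset) (p : Tr n),
    gmap (tree p) (T_ob X) -> T_ob X n :=
  match n with
  | 0 => fun X (p : Tr 0) (f : gmap (tree p) (T_ob X)) =>
      existT _ p (point_map (vertex (f 0 (root p))))
  | n'.+1 => fun X (p : Tr n'.+1) (f : gmap (tree p) (T_ob X)) =>
      let u i := @gseq_homs _ (fun i => tree (fnth p i)) _ f i in
      let x i := trunk (u i) in
      let x0 := vertex (f 0 ord0) in
      let g i (j : 'I_(clen (x i))) :=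
        @mult n' (ghom (cnth (x i) (lend j)) (cnth (x i) (rend j))) (fnth p i)
          (gcomp (gproj _ j) (factor (u i))) in
      existT _ (lex_concat (fun i j => tag (g i j)))
        (@gseq_map _ _ X (lex_chain x0 (w := x))
          (fun l => gcomp
             (hom_cast (@mult_lend _ _ (fnth p) _ f l) (lex_chain_rend x0 l))
             (tagged (g (tagnat.sig1 l) (tagnat.sig2 l)))))
  end.

Arguments mult {n X p} f.

(* Main.v *)
(* Regard an (n+1)-cell of TX as its first 0-cell x_0 (its base) together with
   the list of its branches, n-cells of T(X') where X' is the shift of X, whose
   n-cells are the (n+1)-cells of X. The pair (base, branches) is injective, and
   its image consists of the lists forming a zigzag of 1-cells of X. In these
   terms mu is the recursion

     branches (mu c) = concatenation of [mu d | d in unzip e], e in branches c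

   where unzip : T((TX)') -> List(TT(X')) combines branches with the fact that a
   map from a tree, being connected, to lists is a list of maps. Naturality,
   compatibility with faces, the monad laws and the pullback property all follow
   by induction on the dimension, for all globular sets at once. For pullbacks,
   the branches are lifted one by one along the zigzag.

   T is a parametric right adjoint because the left adjoint at beta : B -> TA is
   the colimit, over the cells b of B, of the trees that are the shapes of the
   beta b. *)
From mathcomp Require Import all_boot all_order.
From mathcomp Require Import boolp.
Require Import Defs.

Set Implicit Arguments.
Unset Strict Implicit.
Unset Printing Implicit Defensive.

(** * Dependent pairs; maps and pullbacks of globular sets built cell by cell *)

Lemma existT_injr (I : Type) (F : I -> Type) (i : I) (x y : F i) :
  existT F i x = existT F i y -> x = y.
Proof.
move=> E; have := projT2_eq E.
by rewrite (Prop_irrelevance (projT1_eq E) erefl).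
Qed.

(** Preimages are picked by choice; injectivity of [i] makes them unique, which forces the chosen
    function to commute with faces. *)
Lemma gmap_lift (P A B : gset) (i : gmap A B) (f : gmap P B) :
  (forall n, injective (i n)) -> (forall n c, exists a, i n a = f n c) ->
  exists f' : gmap P A, f = gcomp i f'.
Proof.
move=> inj im.
pose g n (c : P n) : A n := sval (cid (im n c)).
have gE n c : i n (g n c) = f n c by rewrite /g; case: cid.
have gs n (c : P n.+1) : g n (src c) = src (g n.+1 c).
  by apply: inj; rewrite gE !gsrc gE.
have gt n (c : P n.+1) : g n (tgt c) = tgt (g n.+1 c).
  by apply: inj; rewrite gE !gtgt gE.
by exists (GMap gs gt); apply: gmap_eq => n c /=; rewrite gE.
Qed.

(** Limits of globular sets are computed cellwise: cells of [P] are determined by their two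
    projections, so the mediating functions commute with faces and are unique. *)
Lemma pullback_of_cells (P A B C : gset) (p : gmap P A) (q : gmap P B)
  (f : gmap A C) (g : gmap B C) :
  gcomp f p = gcomp g q ->
  (forall n (a : A n) (b : B n), f n a = g n b ->
    exists! w : P n, p n w = a /\ q n w = b) ->
  @is_pullback Glob P A B C p q f g.
Proof.
move=> comm pb; split=> // Q u v /= E.
have E' n (x : Q n) : f n (u n x) = g n (v n x).
  exact: (congr1 (fun h : gmap Q C => h n x) E).
have inj n (w w' : P n) : p n w = p n w' -> q n w = q n w' -> w = w'.
  move=> ep eq; have e : f n (p n w) = g n (q n w).
    exact: (congr1 (fun h : gmap P C => h n w) comm).
  by have [z [_ zu]] := pb n _ _ e; rewrite -(zu w) // -(zu w').
pose w n (x : Q n) : P n := sval (cid (pb n _ _ (E' n x))).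
have wE n x : p n (w n x) = u n x /\ q n (w n x) = v n x.
  by rewrite /w; case: cid => ? /= [].
have ws n (x : Q n.+1) : w n (src x) = src (w n.+1 x).
  by apply: inj; rewrite !gsrc ?(proj1 (wE _ _)) ?(proj2 (wE _ _)) gsrc.
have wt n (x : Q n.+1) : w n (tgt x) = tgt (w n.+1 x).
  by apply: inj; rewrite !gtgt ?(proj1 (wE _ _)) ?(proj2 (wE _ _)) gtgt.
exists (GMap ws wt); split.
  by split; apply: gmap_eq => n x; case: (wE n x).
move=> w' [ew1 ew2]; apply: gmap_eq => n x; apply: inj.
  by rewrite /= (proj1 (wE n x)) -ew1.
by rewrite /= (proj2 (wE n x)) -ew2.
Qed.

(** * Shifts and lists of globular sets *)

(** This is the coproduct of all homs [ghom a b] of [X], since the 0-dimensional ends of a cell are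
    invariant under its faces. *)
Definition shift (X : gset) : gset :=
  @GSet (fun n => X n.+1) (fun n x => src x) (fun n x => tgt x)
    (fun n x => src_src x) (fun n x => tgt_src x).

Definition shift_map (X Y : gset) (h : gmap X Y) : gmap (shift X) (shift Y) :=
  @GMap (shift X) (shift Y) (fun n x => h n.+1 x)
    (fun n x => gsrc h x) (fun n x => gtgt h x).

Lemma glist_src_src (X : gset) n (s : seq (X n.+2)) :
  map src (map src s) = map src (map tgt s).
Proof. by rewrite -!map_comp; apply: eq_map => x /=; exact: src_src. Qed.

Lemma glist_tgt_src (X : gset) n (s : seq (X n.+2)) :
  map tgt (map src s) = map tgt (map tgt s).
Proof. by rewrite -!map_comp; apply: eq_map => x /=; exact: tgt_src. Qed.

(** Faces preserve length, so this is the coproduct of the finite powers of [X]. A map into it from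
    a connected object is therefore a list of maps. *)
Definition glist (X : gset) : gset :=
  @GSet (fun n => seq (X n)) (fun n s => map src s) (fun n s => map tgt s)
    (@glist_src_src X) (@glist_tgt_src X).

Definition collect_fun (P Y : gset) (F : seq (gmap P Y)) n (c : P n) :
  glist Y n := [seq (g : gmap P Y) n c | g <- F].

Lemma collect_src (P Y : gset) (F : seq (gmap P Y)) n (c : P n.+1) :
  collect_fun F (src c) = src (collect_fun F c).
Proof. by rewrite /= -map_comp; apply: eq_map => g /=; exact: gsrc. Qed.

Lemma collect_tgt (P Y : gset) (F : seq (gmap P Y)) n (c : P n.+1) :
  collect_fun F (tgt c) = tgt (collect_fun F c).
Proof. by rewrite /= -map_comp; apply: eq_map => g /=; exact: gtgt. Qed.

Definition collect (P Y : gset) (F : seq (gmap P Y)) : gmap P (glist Y) :=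
  GMap (collect_src F) (collect_tgt F).

Lemma glist_map_src (X Y : gset) (h : gmap X Y) n (s : glist X n.+1) :
  map (h n) (src s) = src (map (h n.+1) s : glist Y n.+1).
Proof. by rewrite /= -!map_comp; apply: eq_map => x /=; exact: gsrc. Qed.

Lemma glist_map_tgt (X Y : gset) (h : gmap X Y) n (s : glist X n.+1) :
  map (h n) (tgt s) = tgt (map (h n.+1) s : glist Y n.+1).
Proof. by rewrite /= -!map_comp; apply: eq_map => x /=; exact: gtgt. Qed.

Definition glist_map (X Y : gset) (h : gmap X Y) : gmap (glist X) (glist Y) :=
  @GMap (glist X) (glist Y) (fun n => map (h n))
    (@glist_map_src X Y h) (@glist_map_tgt X Y h).

Definition glist_flatten (X : gset) : gmap (glist (glist X)) (glist X) :=
  @GMap (glist (glist X)) (glist X) (fun n => flatten)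
    (fun n s => esym (map_flatten src s)) (fun n s => esym (map_flatten tgt s)).

Lemma gcomp_glist_map_collect (P Y Z : gset) (h : gmap Y Z)
  (F : seq (gmap P Y)) :
  gcomp (glist_map h) (collect F) = collect (map (gcomp h) F).
Proof. by apply: gmap_eq => n c /=; rewrite /collect_fun -!map_comp. Qed.

Lemma gcomp_collect (P Q Y : gset) (F : seq (gmap P Y)) (g : gmap Q P) :
  gcomp (collect F) g = collect [seq gcomp f g | f <- F].
Proof. by apply: gmap_eq => n c /=; rewrite /collect_fun -!map_comp. Qed.

Lemma gcomp_flatten_collect (P Y : gset) (F : seq (seq (gmap P Y))) :
  gcomp (glist_flatten Y) (collect (map (@collect P Y) F)) =
  collect (flatten F).
Proof.
by apply: gmap_eq => n c /=; rewrite /collect_fun map_flatten -map_comp.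
Qed.

Section TreeLists.
Variables (n : nat) (p : Tr n) (Y : gset).

(** A tree has at least one cell, its root; evaluation there separates empty from nonempty lists. *)
Lemma collect_inj : injective (@collect (tree p) Y).
Proof.
move=> F F' EF.
have E k (c : tree p k) : collect F k c = collect F' k c by rewrite EF.
clear EF.
elim: F F' E => [|g F IH] [|g' F'] E //.
- by have := E 0 (root p).
- by have := E 0 (root p).
have -> : g = g' by apply: gmap_eq => k c; have [] := E k c.
by congr cons; apply: IH => k c; have [] := E k c.
Qed.

(** The length of [f k c] is invariant under faces, hence constant by connectedness. Induction on
    this length splits off the heads as one map and the tails as another. *)
Lemma collect_surj (f : gmap (tree p) (glist Y)) : exists F, f = collect F.
Proof.
have sz k (c : tree p k) : size (f k c) = size (f 0 (root p)).
  apply: (tree_connected (phi := fun k c => size (f k c))) => {}k {}c.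
    by rewrite gsrc /= size_map.
  by rewrite gtgt /= size_map.
move: (size _) sz => m; elim: m f => [|m IH] f sz.
  exists [::]; apply: gmap_eq => k c; exact/size0nil/sz.
have ex k (c : tree p k) : exists ys : Y k * seq (Y k), f k c = ys.1 :: ys.2.
  by have := sz k c; case: (f k c) => // y s _; exists (y, s).
pose g k c := sval (cid (ex k c)).
have gE k c : f k c = (g k c).1 :: (g k c).2 by rewrite /g; case: cid.
have hs k (c : tree p k.+1) : (g k (src c)).1 = src (g _ c).1.
  by have := gsrc f c; rewrite gE [f _ c]gE => -[].
have ht k (c : tree p k.+1) : (g k (tgt c)).1 = tgt (g _ c).1.
  by have := gtgt f c; rewrite gE [f _ c]gE => -[].
have ts k (c : tree p k.+1) :
    (g k (src c)).2 = src ((g _ c).2 : glist Y k.+1).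
  by have := gsrc f c; rewrite gE [f _ c]gE => -[].
have tt k (c : tree p k.+1) :
    (g k (tgt c)).2 = tgt ((g _ c).2 : glist Y k.+1).
  by have := gtgt f c; rewrite gE [f _ c]gE => -[].
have [|F EF] := IH (@GMap (tree p) (glist Y) (fun k c => (g k c).2) ts tt).
  by move=> k c /=; have := sz k c; rewrite gE => -[].
exists (@GMap (tree p) Y (fun k c => (g k c).1) hs ht :: F).
apply: gmap_eq => k c; rewrite gE; congr cons.
exact: (congr1 (fun h : gmap _ _ => h k c) EF).
Qed.

End TreeLists.

Lemma collect_surj2 n (p : Tr n) Y (f : gmap (tree p) (glist (glist Y))) :
  exists F, f = collect (map (@collect (tree p) Y) F).
Proof.
have [F ->] := collect_surj f.
elim: F => [|g F [G /collect_inj ->]]; first by exists [::].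
by have [H ->] := collect_surj g; exists (H :: G).
Qed.

(* Trees are connected, so the length of a list-valued map is constant. *)
Definition spread_fun (Y : gset) n (c : T_ob (glist Y) n) : seq (T_ob Y n) :=
  [seq existT _ (tag c) g | g <- sval (cid (collect_surj (tagged c)))].

Lemma spread_funE (Y : gset) n (p : Tr n) (F : seq (gmap (tree p) Y)) :
  spread_fun (existT _ p (collect F)) = [seq existT _ p g | g <- F].
Proof. by rewrite /spread_fun /=; case: cid => G /= /collect_inj ->. Qed.

Lemma spread_src (Y : gset) n (c : T_ob (glist Y) n.+1) :
  spread_fun (src c) = src (spread_fun c : glist (T_ob Y) n.+1).
Proof.
case: c => p f; have [F ->] := collect_surj f.
rewrite {1}/src /= /T_src /= gcomp_collect !spread_funE.
by rewrite -!map_comp.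
Qed.

Lemma spread_tgt (Y : gset) n (c : T_ob (glist Y) n.+1) :
  spread_fun (tgt c) = tgt (spread_fun c : glist (T_ob Y) n.+1).
Proof.
case: c => p f; have [F ->] := collect_surj f.
rewrite {1}/tgt /= /T_tgt /= gcomp_collect !spread_funE.
by rewrite -!map_comp.
Qed.

Definition spread (Y : gset) : gmap (T_ob (glist Y)) (glist (T_ob Y)) :=
  @GMap (T_ob (glist Y)) (glist (T_ob Y)) (@spread_fun Y)
    (@spread_src Y) (@spread_tgt Y).

Lemma spread_collect (P Y : gset) (F : seq (gmap P Y)) n (c : T_ob P n) :
  spread Y n (T_map (collect F) n c) = [seq T_map g n c | g <- F].
Proof.
case: c => p f; rewrite /= /T_map_fun /= gcomp_collect spread_funE.
by rewrite -map_comp.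
Qed.

Lemma spread_nat (Y Z : gset) (h : gmap Y Z) n (c : T_ob (glist Y) n) :
  spread Z n (T_map (glist_map h) n c) = map (T_map h n) (spread Y n c).
Proof.
case: c => p f; have [F ->] := collect_surj f.
rewrite /= /T_map_fun /= gcomp_glist_map_collect !spread_funE.
by rewrite -!map_comp.
Qed.

(** Compatibility with the multiplication of the list monad. With [spread_eta] and [spread_mu] it
    gives three of the four axioms of a distributive law of T over lists. *)
Lemma spread_flatten (Y : gset) n (c : T_ob (glist (glist Y)) n) :
  spread Y n (T_map (glist_flatten Y) n c) =
  flatten (map (spread Y n) (spread (glist Y) n c)).
Proof.
case: c => p f; have [F ->] := collect_surj2 f.
rewrite /= /T_map_fun /= gcomp_flatten_collect !spread_funE map_flatten.
congr flatten; rewrite -!map_comp; apply: eq_map => G /=.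
by rewrite spread_funE.
Qed.

(** The shapes are compared separately because [spread] forgets the shape when its value is the
    empty list. *)
Lemma spread_inj (Y : gset) n (c c' : T_ob (glist Y) n) :
  tag c = tag c' -> spread Y n c = spread Y n c' -> c = c'.
Proof.
case: c c' => p f [p' f'] /= e; subst p'.
have [F ->] := collect_surj f; have [F' ->] := collect_surj f'.
rewrite !spread_funE => E; suff -> : F = F' by [].
elim: F F' E => [|g F IH] [|g' F'] //= E.
have E1 : g = g' by exact: existT_injr (congr1 (head (existT _ p g)) E).
by rewrite E1 (IH F' (congr1 behead E)).
Qed.

(** * Cells of TX as lists of branches *)

Definition base (X : gset) n (c : T_ob X n) : X 0 := tagged c 0 (root (tag c)).

Lemma base_map (X Y : gset) (h : gmap X Y) n (c : T_ob X n) :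
  base (T_map h n c) = h 0 (base c).
Proof. by []. Qed.

Lemma base_src (X : gset) n (c : T_ob X n.+1) : base (src c) = base c.
Proof. by case: n c. Qed.

(** Restricted to dimension at least 2: the target of a 1-cell is the other end of its zigzag, see
    [base_tgt1]. *)
Lemma base_tgt (X : gset) n (c : T_ob X n.+2) : base (tgt c) = base c.
Proof. by []. Qed.

Lemma base_spread (Y : gset) n (c : T_ob (glist Y) n) :
  map (@base Y n) (spread Y n c) = base c.
Proof.
case: c => p f; have [F ->] := collect_surj f.
by rewrite /= spread_funE -map_comp.
Qed.

Definition pt (X : gset) (x : X 0) : T_ob X 0 :=
  existT (fun p => gmap (tree p) X) (tt : Tr 0) (point_map x).

Lemma pt_base (X : gset) (c : T_ob X 0) : pt (base c) = c.
Proof.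
by case: c => -[] f; congr (existT _ _ _); apply: gmap_eq => -[|n] [].
Qed.

Lemma base_inj (X : gset) : injective (@base X 0).
Proof. by move=> c c' E; rewrite -(pt_base c) E pt_base. Qed.

Lemma branch_src k (X : 'I_k -> gset) (Z : gset) (f : gmap (gseq X) Z) i m
  (z : X i m.+1) :
  f m.+1 (existT _ i (src z)) = src (f m.+2 (existT (fun i => X i m.+1) i z)).
Proof. exact: (gsrc f (existT (fun i => X i m.+1) i z : gseq X m.+2)). Qed.

Lemma branch_tgt k (X : 'I_k -> gset) (Z : gset) (f : gmap (gseq X) Z) i m
  (z : X i m.+1) :
  f m.+1 (existT _ i (tgt z)) = tgt (f m.+2 (existT (fun i => X i m.+1) i z)).
Proof. exact: (gtgt f (existT (fun i => X i m.+1) i z : gseq X m.+2)). Qed.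

Definition branch k (X : 'I_k -> gset) (Z : gset) (f : gmap (gseq X) Z) i :
    gmap (X i) (shift Z) :=
  @GMap (X i) (shift Z) (fun m z => f m.+1 (existT _ i z))
    (fun m z => branch_src f z) (fun m z => branch_tgt f z).

Definition branch_at (X : gset) n (c : T_ob X n.+1) (i : 'I_(flen (tag c))) :
    T_ob (shift X) n :=
  existT (fun p => gmap (tree p) (shift X)) (fnth (tag c) i)
    (branch (X := fun i => tree (fnth (tag c) i)) (tagged c) i).

Definition branches_fun (X : gset) n (c : T_ob X n.+1) :
    seq (T_ob (shift X) n) :=
  map (branch_at (c := c)) (enum 'I_(flen (tag c))).

Lemma branches_src (X : gset) n (c : T_ob X n.+2) :
  branches_fun (src c) = src (branches_fun c : glist (T_ob (shift X)) n.+1).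
Proof.
have E (i : 'I_(flen (tag c))) :
    branch_at (c := src c) i = src (branch_at (c := c) i).
  by congr (existT _ _ _); apply: gmap_eq.
exact: etrans (eq_map E _) (map_comp _ _ _).
Qed.

Lemma branches_tgt (X : gset) n (c : T_ob X n.+2) :
  branches_fun (tgt c) = tgt (branches_fun c : glist (T_ob (shift X)) n.+1).
Proof.
have E (i : 'I_(flen (tag c))) :
    branch_at (c := tgt c) i = tgt (branch_at (c := c) i).
  by congr (existT _ _ _); apply: gmap_eq.
exact: etrans (eq_map E _) (map_comp _ _ _).
Qed.

(* The branches are labelled in the shift of X rather than in the homs
   X(x_{j-1},x_j), so that the dependent product becomes a plain list. *)
Definition branches (X : gset) :
    gmap (shift (T_ob X)) (glist (T_ob (shift X))) :=
  @GMap (shift (T_ob X)) (glist (T_ob (shift X))) (@branches_fun X)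
    (@branches_src X) (@branches_tgt X).

Lemma branches_nat (X Y : gset) (h : gmap X Y) n (c : T_ob X n.+1) :
  branches Y n (T_map h n.+1 c) =
  map (T_map (shift_map h) n) (branches X n c).
Proof.
have E (i : 'I_(flen (tag c))) : branch_at (c := T_map h n.+1 c) i =
    T_map (shift_map h) n (branch_at (c := c) i).
  by congr (existT _ _ _); apply: gmap_eq.
exact: etrans (eq_map E _) (map_comp _ _ _).
Qed.

Lemma size_branches (X : gset) n (c : T_ob X n.+1) :
  size (branches X n c) = flen (tag c).
Proof. by rewrite size_map size_enum_ord. Qed.

Lemma ord_case k (P : 'I_k.+1 -> Prop) :
  P ord0 -> (forall i, P (rend i)) -> forall j, P j.
Proof. by move=> P0 PS j; case: (unliftP ord0 j) => [i|] -> //; exact: PS. Qed.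

(** The branches record the arity, the subtrees and all labels in positive dimension. Every 0-cell
    other than the first is a target of the root of some branch, so its label is determined too. *)
Lemma T_cell_inj (X : gset) n (c c' : T_ob X n.+1) :
  base c = base c' -> branches X n c = branches X n c' -> c = c'.
Proof.
case: c c' => [[k q] f] [[k' q'] f']; rewrite /base /= => eb E.
have ek : k = k'.
  by have := congr1 size E; rewrite !size_branches.
subst k'.
have E' i : existT (fun p => gmap (tree p) (shift X)) (q i)
    (branch (X := fun i => tree (q i)) f i) =
    existT _ (q' i) (branch (X := fun i => tree (q' i)) f' i).
  by move/eq_in_map: E => /(_ i (mem_enum _ i)).
have eq : q = q' by apply/funext => i; exact: (congr1 (@projT1 _ _) (E' i)).
subst q'; congr (existT _ _ _).
have Eb i : branch (X := fun i => tree (q i)) f i =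
    branch (X := fun i => tree (q i)) f' i.
  exact: existT_injr (E' i).
have E1 m i (z : tree (q i) m) : f m.+1 (existT _ i z) = f' m.+1 (existT _ i z).
  exact: (congr1 (fun g : gmap (tree (q i)) (shift X) => g m z) (Eb i)).
apply: gmap_eq => -[|m] /=; last by case.
apply: ord_case => // i.
have := gtgt f (existT (fun i => tree (q i) 0) i (root (q i)) : gseq _ 1).
by rewrite E1 -gtgt.
Qed.

(** * Zigzags: which lists of branches come from a cell *)

Section Ends.
Variable X : gset.

(** [beg] and [fin] are the ends of the hom of [X] in which all labels of the branch lie: by
    connectedness every label has the same 0-dimensional source and target as the label of the
    root. *)
Definition beg n (c : T_ob (shift X) n) : X 0 := src (base c : X 1).
Definition fin n (c : T_ob (shift X) n) : X 0 := tgt (base c : X 1).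

Lemma src0_tagged n (c : T_ob (shift X) n) k (z : tree (tag c) k) :
  src0 (tagged c k z : X k.+1) = beg c.
Proof.
by apply: (tree_connected (phi := fun k z => src0 (tagged c k z : X k.+1)))
  => {}k {}z; rewrite ?gsrc ?gtgt //; exact: src0_tgt.
Qed.

Lemma tgt0_tagged n (c : T_ob (shift X) n) k (z : tree (tag c) k) :
  tgt0 (tagged c k z : X k.+1) = fin c.
Proof.
by apply: (tree_connected (phi := fun k z => tgt0 (tagged c k z : X k.+1)))
  => {}k {}z; rewrite ?gsrc ?gtgt //; exact: tgt0_src.
Qed.

Lemma beg_src n (c : T_ob (shift X) n.+1) : beg (src c) = beg c.
Proof. by rewrite /beg base_src. Qed.

Lemma fin_src n (c : T_ob (shift X) n.+1) : fin (src c) = fin c.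
Proof. by rewrite /fin base_src. Qed.

Lemma beg_tgt n (c : T_ob (shift X) n.+1) : beg (tgt c) = beg c.
Proof. exact: (@src0_tagged _ c 0). Qed.

Lemma fin_tgt n (c : T_ob (shift X) n.+1) : fin (tgt c) = fin c.
Proof. exact: (@tgt0_tagged _ c 0). Qed.

Fixpoint zigzag n (x : X 0) (s : seq (T_ob (shift X) n)) : Prop :=
  if s is c :: s' then beg c = x /\ zigzag (fin c) s' else True.

Definition zigzag_end n (x : X 0) (s : seq (T_ob (shift X) n)) : X 0 :=
  last x (map (@fin n) s).

Lemma zigzag_cat n x (s t : seq (T_ob (shift X) n)) :
  zigzag x (s ++ t) <-> zigzag x s /\ zigzag (zigzag_end x s) t.
Proof.
elim: s x => [|c s IH] x /=; first by split=> // -[].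
by rewrite IH; split=> [[-> [? ?]]|[[-> ?] ?]].
Qed.

Lemma zigzag_nth n x (s : seq (T_ob (shift X) n)) :
  zigzag x s -> forall i : 'I_(size s),
    beg (tnth (in_tuple s) i) = nth x (x :: map (@fin n) s) i.
Proof.
elim: s x => [|c s IH] x /=; first by move=> _ [].
move=> [ec /IH zs] [[|i] lt]; rewrite (tnth_nth c) //=.
have := zs (Ordinal (lt : i < size s)); rewrite (tnth_nth c) /= => ->.
case: i lt => [|i] //= lt; apply: set_nth_default; rewrite size_map.
exact: ltnW.
Qed.

Lemma zigzag_enum n k (x : 'I_k.+1 -> X 0) (F : 'I_k -> T_ob (shift X) n) :
  (forall i, beg (F i) = x (lend i)) -> (forall i, fin (F i) = x (rend i)) ->
  zigzag (x ord0) (map F (enum 'I_k)) /\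
  zigzag_end (x ord0) (map F (enum 'I_k)) = x ord_max.
Proof.
elim: k x F => [|k IH] x F hb hf.
  rewrite enum_ord0; split=> //; rewrite /zigzag_end /=; congr x.
  exact: val_inj.
have [i|i|zz ee] := IH (fun j => x (lift ord0 j)) (fun i => F (lift ord0 i)).
- by rewrite hb; congr x; exact: val_inj.
- by rewrite hf.
rewrite enum_ordSl /= -map_comp; split.
  by rewrite hf; split=> //; rewrite hb; congr x; exact: val_inj.
rewrite /zigzag_end /= hf; apply: etrans ee _; congr x; exact: val_inj.
Qed.

Lemma branches_ends n (c : T_ob X n.+1) :
  zigzag (base c) (branches X n c) /\
  zigzag_end (base c) (branches X n c) = tagged c 0 ord_max.
Proof.
case: c => p f; apply: (@zigzag_enum _ _ (fun j => f 0 j)) => i.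
  exact/esym/(gsrc f
    (existT (fun i => tree (fnth p i) 0) i (root _) : tree p 1)).
exact/esym/(gtgt f
  (existT (fun i => tree (fnth p i) 0) i (root _) : tree p 1)).
Qed.

Lemma zigzag_branches n (c : T_ob X n.+1) : zigzag (base c) (branches X n c).
Proof. exact: (proj1 (branches_ends c)). Qed.

Lemma base_tgt1 (c : T_ob X 1) :
  base (tgt c) = zigzag_end (base c) (branches X 0 c).
Proof. by rewrite (proj2 (branches_ends c)). Qed.

(** The zigzag condition puts each branch in the hom between two consecutive vertices; the branches
    corestricted to these homs assemble by [gseq_map]. *)
Lemma T_cell_surj n (x : X 0) (s : seq (T_ob (shift X) n)) :
  zigzag x s -> exists c : T_ob X n.+1, base c = x /\ branches X n c = s.
Proof.
move=> /zigzag_nth zs.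
pose q i := tag (tnth (in_tuple s) i).
(* The vertices are [x] followed by the ends of the branches; the default of [nth] is never reached,
   the list having [size s + 1] entries. *)
pose x' (j : 'I_(size s).+1) := nth x (x :: map (@fin n) s) j.
pose f i : gmap (tree (q i)) (shift X) := tagged (tnth (in_tuple s) i).
have hs i m (z : tree (q i) m) :
    src0 (f i m z : X m.+1) = x' (lend i) /\
    tgt0 (f i m z : X m.+1) = x' (rend i).
  rewrite src0_tagged tgt0_tagged zs; split=> //.
  rewrite /x' /rend lift0 /= (nth_map (tnth (in_tuple s) i)) //.
  by congr fin; exact: tnth_nth.
pose g0 i m (z : tree (q i) m) : ghom (x' (lend i)) (x' (rend i)) m :=
  exist _ (f i m z : X m.+1) (hs i m z).
have gs i m (z : tree (q i) m.+1) : g0 i m (src z) = src (g0 i m.+1 z).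
  by apply: hom_cell_eq; exact: (gsrc (f i)).
have gt i m (z : tree (q i) m.+1) : g0 i m (tgt z) = tgt (g0 i m.+1 z).
  by apply: hom_cell_eq; exact: (gtgt (f i)).
pose g i := GMap (gs i) (gt i).
exists (existT (fun p : Tr n.+1 => gmap (tree p) X) (FSeq (size s) q)
   (gseq_map g)).
split=> //; rewrite -[RHS](map_tnth_enum (in_tuple s)).
rewrite /= /branches_fun /=; apply: eq_map => i.
transitivity (existT (fun p => gmap (tree p) (shift X)) (q i) (f i)).
  by congr (existT _ _ _); apply: gmap_eq.
by rewrite /q /f; case: (tnth _ i).
Qed.

End Ends.

(** * The recursion for the multiplication *)

(** The ranking is increasing for the lexicographic order, so listing the pairs row by row lists
    their ranks in increasing order. *)
Lemma rank_enum k (m : 'I_k -> nat) :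
  [seq tagnat.rank s |
    s <- flatten [seq [seq Tagged (fun i => 'I_(m i)) j | j <- enum 'I_(m i)]
                 | i <- enum 'I_k]] = enum 'I_(\sum_i m i).
Proof.
apply: (inj_map val_inj); rewrite val_enum_ord -map_comp map_flatten -map_comp.
(* [off t] counts the pairs in the rows before [t], so row [i] has the ranks from [off i] on and the
   first [t] rows fill [iota 0 (off t)]. *)
pose off t := \sum_(i < k | i < t) m i.
pose H (i : 'I_k) := [seq off i + j | j <- iota 0 (m i)].
transitivity (flatten (map H (enum 'I_k))).
  congr flatten; apply: eq_map => i; rewrite /= /H -val_enum_ord -!map_comp.
  by apply: eq_map => j; exact: tagnat.rankEsum.
have step t : t <= k -> flatten (map H (take t (enum 'I_k))) = iota 0 (off t).
  elim: t => [|t IH] lt; first by rewrite take0 /off big_pred0.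
  pose i := Ordinal lt; have offS : off t.+1 = off t + m i.
    rewrite /off (bigD1 i) //= addnC; congr (_ + _); apply: eq_bigl => j.
    by rewrite ltnS -val_eqE /= [RHS]ltn_neqAle andbC.
  rewrite (take_nth i) ?size_enum_ord // map_rcons flatten_rcons IH;
    last exact: ltnW.
  by rewrite (nth_ord_enum i i) offS iotaD /H -iotaDl addn0.
have := step k (leqnn k); rewrite take_oversize ?size_enum_ord // => ->.
by rewrite /off; congr iota; apply: eq_bigl => i; rewrite ltn_ord.
Qed.

Lemma lex_enum k (m : 'I_k -> nat) (A : Type)
  (G : forall i, 'I_(m i) -> A) :
  [seq G (tagnat.sig1 l) (tagnat.sig2 l) | l <- enum 'I_(\sum_i m i)] =
  flatten [seq [seq G i j | j <- enum 'I_(m i)] | i <- enum 'I_k].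
Proof.
rewrite -rank_enum -map_comp map_flatten -map_comp; congr flatten.
apply: eq_map => i; rewrite /= -map_comp; apply: eq_map => j /=.
by rewrite /tagnat.sig2 /tagnat.sig1 tagnat.rankK.
Qed.

Section Hom.
Variables (X : gset) (a b : X 0).

Definition ghom_incl : gmap (ghom a b) (shift X) :=
  @GMap (ghom a b) (shift X) (fun n c => sval c)
    (fun _ _ => erefl) (fun _ _ => erefl).

End Hom.

Definition mu_cell (X : gset) n (c : T_ob (T_ob X) n) : T_ob X n :=
  mult (tagged c).

Lemma base_mu (X : gset) n (c : T_ob (T_ob X) n) :
  base (mu_cell c) = base (base c).
Proof.
by case: n c => [|n] [p f] //; rewrite /base /= /lex_chain unlift_none.
Qed.

(* The factorization of p_i -> {TX}(f(i-1),f(i)) into the f_ij, as a list. *)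
Definition unzip_map (X : gset) :
    gmap (T_ob (shift (T_ob X))) (glist (T_ob (T_ob (shift X)))) :=
  gcomp (spread _) (T_map (branches X)).

(** The chain [w] is a variable so that elimination of [e] removes the transport that occurs in
    [factor_fun]. *)
Lemma branches_spine (X : gset) m (d : T_ob X m.+1) (w : chain (X 0))
  (e : spine d = w) :
  branches X m d =
  [seq T_map (ghom_incl (cnth w (lend j)) (cnth w (rend j))) m
         (eq_rect _ (fun v => summand v m) (component d) w e j)
  | j <- enum 'I_(clen w)].
Proof.
case: w / e => /=; apply: eq_map => j.
by congr (existT _ _ _); apply: gmap_eq.
Qed.

Lemma branches_factor n (p : Tr n) (X : gset) (a b : T_ob X 0)
  (u : gmap (tree p) (ghom a b)) :
  gcomp (branches X) (gcomp (ghom_incl a b) u) =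
  collect [seq gcomp (T_map (ghom_incl _ _)) (gcomp (gproj _ j) (factor u))
          | j <- enum 'I_(clen (trunk u))].
Proof.
apply: gmap_eq => m c; apply: etrans (branches_spine (spine_trunk u c)) _.
by rewrite /= /collect_fun -map_comp; apply: eq_map => j.
Qed.

(** [mult] recurses into T of the homs of [X], whereas branches live over the shift; naturality
    along [ghom_incl] passes from one to the other. Naturality in dimension [n] is a hypothesis
    because its own proof by induction uses this recursion. *)
Lemma mu_branches_of_nat n :
  (forall (X Y : gset) (h : gmap X Y) (c : T_ob (T_ob X) n),
     mu_cell (T_map (T_map h) n c) = T_map h n (mu_cell c)) ->
  forall (X : gset) (c : T_ob (T_ob X) n.+1),
    branches X n (mu_cell c) =
    flatten [seq map (@mu_cell _ n) (unzip_map X n e)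
            | e <- branches (T_ob X) n c].
Proof.
move=> nat_n X [p f].
pose u i := @gseq_homs _ (fun i => tree (fnth p i)) _ f i.
pose x i := trunk (u i).
pose g i (j : 'I_(clen (x i))) :=
  @mult n (ghom (cnth (x i) (lend j)) (cnth (x i) (rend j))) (fnth p i)
    (gcomp (gproj _ j) (factor (u i))).
pose G i j := T_map (ghom_incl _ _) n (g i j).
transitivity [seq G (tagnat.sig1 l) (tagnat.sig2 l)
             | l <- enum 'I_(\sum_i clen (x i))].
  apply: eq_map => l.
  by congr (existT _ _ _); apply: gmap_eq.
rewrite lex_enum; congr flatten.
have E i : [seq G i j | j <- enum 'I_(clen (x i))] =
    map (@mu_cell _ n) (unzip_map X n (branch_at (c := existT _ p f) i)).
  have -> : unzip_map X n (branch_at (c := existT _ p f) i) = spread _ n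
      (existT _ (fnth p i) (gcomp (branches X) (gcomp (ghom_incl _ _) (u i)))).
    by congr (spread _ n (existT _ _ _)); apply: gmap_eq.
  rewrite branches_factor /= spread_funE -!map_comp; apply: eq_map => j.
  exact: esym (nat_n _ _ _ (existT _ (fnth p i) _)).
rewrite (eq_map E).
exact: (map_comp (fun e => map (@mu_cell _ n) (unzip_map X n e))
  (branch_at (c := existT _ p f)) (enum 'I_(flen p))).
Qed.

Lemma map_square (A B B' C : Type) (f : A -> B) (g : B -> C) (f' : A -> B')
  (g' : B' -> C) (s : seq A) :
  (forall a, g (f a) = g' (f' a)) -> map g (map f s) = map g' (map f' s).
Proof. by move=> E; rewrite -!map_comp; exact: eq_map. Qed.

Lemma map_flatten_square (A A' B C : Type) (f : A -> A') (F : A' -> seq C)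
  (g : B -> C) (G : A -> seq B) (s : seq A) :
  (forall a, F (f a) = map g (G a)) ->
  flatten (map F (map f s)) = map g (flatten (map G s)).
Proof.
by move=> E; rewrite map_flatten -!map_comp (eq_map (g := map g \o G)).
Qed.

Lemma T_map_comp (X Y Z : gset) (g : gmap Y Z) (f : gmap X Y) n (c : T_ob X n) :
  T_map g n (T_map f n c) = T_map (gcomp g f) n c.
Proof. by rewrite T_mapM. Qed.

Lemma gcomp_branches (X Y : gset) (h : gmap X Y) :
  gcomp (branches Y) (shift_map (T_map h)) =
  gcomp (glist_map (T_map (shift_map h))) (branches X).
Proof. by apply: gmap_eq => n c; exact: branches_nat. Qed.

Lemma unzip_nat (X Y : gset) (h : gmap X Y) n (e : T_ob (shift (T_ob X)) n) :
  unzip_map Y n (T_map (shift_map (T_map h)) n e) =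
  map (T_map (T_map (shift_map h)) n) (unzip_map X n e).
Proof.
transitivity (spread _ n (T_map (branches Y) n
    (T_map (shift_map (T_map h)) n e))) => //.
by rewrite T_map_comp gcomp_branches -T_map_comp spread_nat.
Qed.

Lemma mu_nat n (X Y : gset) (h : gmap X Y) (c : T_ob (T_ob X) n) :
  mu_cell (T_map (T_map h) n c) = T_map h n (mu_cell c).
Proof.
elim: n X Y h c => [|n IH] X Y h c; first by apply: base_inj.
apply: T_cell_inj; first by rewrite base_mu !base_map base_mu.
have step := mu_branches_of_nat IH.
have E e : map (@mu_cell _ n)
      (unzip_map Y n (T_map (shift_map (T_map h)) n e)) =
    map (T_map (shift_map h) n) (map (@mu_cell _ n) (unzip_map X n e)).
  by rewrite unzip_nat; apply: map_square => d; exact: IH.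
by rewrite branches_nat !step branches_nat; apply: map_flatten_square; exact: E.
Qed.

Lemma mu_branches n (X : gset) (c : T_ob (T_ob X) n.+1) :
  branches X n (mu_cell c) =
  flatten [seq map (@mu_cell _ n) (unzip_map X n e)
          | e <- branches (T_ob X) n c].
Proof. exact: mu_branches_of_nat (@mu_nat n) X c. Qed.

(** Both ends can be read at the root of [e]: the branches there are the bases of the factors of
    [e], and [mu_cell] preserves the underlying base. *)
Lemma fin_base_mu n (X : gset) (e : T_ob (shift (T_ob X)) n) :
  base (fin e) =
  zigzag_end (base (base e : T_ob X 1)) (map (@mu_cell _ n) (unzip_map X n e)).
Proof.
rewrite /fin base_tgt1; congr last; rewrite /zigzag_end.
have := base_spread (T_map (branches X) n e).
rewrite base_map => <-; rewrite -!map_comp; apply: eq_map => d /=.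
by rewrite /fin base_mu.
Qed.

(** Replacing each branch by its multiplied factors refines the zigzag without moving its end. This
    is what [mu_tgt] needs for 1-cells. *)
Lemma base_zigzag_end n (X : gset) (y : T_ob X 0)
  (s : seq (T_ob (shift (T_ob X)) n)) : zigzag y s ->
  base (zigzag_end y s) = zigzag_end (base y)
    (flatten [seq map (@mu_cell _ n) (unzip_map X n e) | e <- s]).
Proof.
elim: s y => [|e s IH] y //= [ey zs].
rewrite /zigzag_end /= map_cat last_cat.
have := IH _ zs; rewrite /zigzag_end => ->; congr last.
by rewrite fin_base_mu /zigzag_end -ey /beg base_src.
Qed.

Lemma mu_src n (X : gset) (c : T_ob (T_ob X) n.+1) :
  mu_cell (src c) = src (mu_cell c).
Proof.
elim: n X c => [|n IH] X c.
  by apply: base_inj; rewrite base_src !base_mu !base_src.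
apply: T_cell_inj; first by rewrite base_src !base_mu !base_src.
rewrite mu_branches.
have -> : branches X n (src (mu_cell c)) = src (branches X n.+1 (mu_cell c)).
  exact: (gsrc (branches X) (mu_cell c : shift (T_ob X) n.+1)).
have -> : branches _ n (src c) = src (branches _ n.+1 c).
  exact: (gsrc (branches _) (c : shift (T_ob _) n.+1)).
have E e : map (@mu_cell _ n) (unzip_map X n (src e)) =
    map src (map (@mu_cell _ n.+1) (unzip_map X n.+1 e)).
  by rewrite (gsrc (unzip_map X)); apply: map_square => c'; exact: IH.
by rewrite mu_branches; apply: map_flatten_square; exact: E.
Qed.

Lemma mu_tgt n (X : gset) (c : T_ob (T_ob X) n.+1) :
  mu_cell (tgt c) = tgt (mu_cell c).
Proof.
elim: n X c => [|n IH] X c.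
  apply: base_inj; rewrite base_mu !base_tgt1 mu_branches base_mu.
  exact: base_zigzag_end (zigzag_branches c).
apply: T_cell_inj; first by rewrite base_tgt !base_mu !base_tgt.
rewrite mu_branches.
have -> : branches X n (tgt (mu_cell c)) = tgt (branches X n.+1 (mu_cell c)).
  exact: (gtgt (branches X) (mu_cell c : shift (T_ob X) n.+1)).
have -> : branches _ n (tgt c) = tgt (branches _ n.+1 c).
  exact: (gtgt (branches _) (c : shift (T_ob _) n.+1)).
have E e : map (@mu_cell _ n) (unzip_map X n (tgt e)) =
    map tgt (map (@mu_cell _ n.+1) (unzip_map X n.+1 e)).
  by rewrite (gtgt (unzip_map X)); apply: map_square => c'; exact: IH.
by rewrite mu_branches; apply: map_flatten_square; exact: E.
Qed.

Definition mu_map (X : gset) : gmap (T_ob (T_ob X)) (T_ob X) :=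
  @GMap (T_ob (T_ob X)) (T_ob X) (fun n c => mu_cell c)
    (fun n c => mu_src c) (fun n c => mu_tgt c).

(** * The unit *)

Definition eta_cell (X : gset) n (x : X n) : T_ob X n :=
  existT (fun p => gmap (tree p) X) (globe n) (globe_map x).

Lemma base_eta (X : gset) n (x : X n.+1) : base (eta_cell x) = src0 x.
Proof. by []. Qed.

Lemma branches_eta (X : gset) n (x : X n.+1) :
  branches X n (eta_cell x) = [:: @eta_cell (shift X) n x].
Proof.
rewrite /branches /= /branches_fun enum_ordSl enum_ord0 /=; congr [:: _].
by congr (existT _ _ _); apply: globe_mapP; rewrite /= globe_map_top.
Qed.

Lemma eta_nat (X Y : gset) (h : gmap X Y) n (x : X n) :
  T_map h n (eta_cell x) = eta_cell (h n x).
Proof.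
by congr (existT _ _ _); apply: globe_mapP; rewrite /= globe_map_top.
Qed.

Lemma eta_src n (X : gset) (x : X n.+1) :
  eta_cell (src x) = src (eta_cell x).
Proof.
elim: n X x => [|n IH] X x; first exact: base_inj.
apply: T_cell_inj; first by rewrite base_src !base_eta.
have -> : branches X n (src (eta_cell x)) = src (branches X n.+1 (eta_cell x)).
  exact: (gsrc (branches X) (eta_cell x : shift (T_ob X) n.+1)).
by rewrite !branches_eta; congr [:: _]; exact: (IH (shift X)).
Qed.

Lemma eta_tgt n (X : gset) (x : X n.+1) :
  eta_cell (tgt x) = tgt (eta_cell x).
Proof.
elim: n X x => [|n IH] X x.
  by apply: base_inj; rewrite base_tgt1 branches_eta.
apply: T_cell_inj; first by rewrite base_tgt !base_eta src0_tgt.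
have -> : branches X n (tgt (eta_cell x)) = tgt (branches X n.+1 (eta_cell x)).
  exact: (gtgt (branches X) (eta_cell x : shift (T_ob X) n.+1)).
by rewrite !branches_eta; congr [:: _]; exact: (IH (shift X)).
Qed.

Definition eta_map (X : gset) : gmap X (T_ob X) :=
  @GMap X (T_ob X) (@eta_cell X) (fun n x => eta_src x) (fun n x => eta_tgt x).

(** * Monad laws *)

Lemma base_src0 (X : gset) n (c : T_ob X n.+1) : base (src0 c) = base c.
Proof. by elim: n c => [|n IH] c /=; rewrite ?IH base_src. Qed.

Lemma spread_eta (Y : gset) n (s : glist Y n) :
  spread Y n (eta_cell s) = map (@eta_cell Y n) s.
Proof.
have E : globe_map s = collect (map (@globe_map n Y) s).
  apply/esym/globe_mapP; rewrite /= /collect_fun -map_comp -[RHS]map_id.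
  by apply: eq_map => y /=; exact: globe_map_top.
by rewrite /= /eta_cell E spread_funE -map_comp.
Qed.

(** The only branch of [eta_cell c] is the unit at [c] seen in the shift; by naturality of the unit
    and [spread_eta] it unzips to the units at the branches of [c]. *)
Lemma mu_eta n (X : gset) (c : T_ob X n) : mu_cell (eta_cell c) = c.
Proof.
elim: n X c => [|n IH] X c; first exact: base_inj.
apply: T_cell_inj; first by rewrite base_mu base_eta base_src0.
rewrite mu_branches branches_eta [LHS]cats0.
have -> : unzip_map X n (@eta_cell (shift (T_ob X)) n c) =
    map (@eta_cell _ n) (branches X n c).
  rewrite -spread_eta; congr (spread _ n).
  exact: (eta_nat (branches X)).
by rewrite -[LHS]map_comp -[RHS]map_id; apply: eq_map => d; exact: IH.
Qed.

Lemma mu_T_eta n (X : gset) (c : T_ob X n) :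
  mu_cell (T_map (eta_map X) n c) = c.
Proof.
elim: n X c => [|n IH] X c; first exact: base_inj.
apply: T_cell_inj; first by rewrite base_mu base_map.
(* A unit cell has exactly one branch, so a branch [e] relabelled by units unzips to a single
   factor, which multiplies back to [e]. *)
have E : gcomp (branches X) (shift_map (eta_map X)) =
    collect [:: eta_map (shift X)].
  by apply: gmap_eq => m x; exact: branches_eta.
rewrite mu_branches branches_nat.
have E' e : map (@mu_cell _ n)
    (unzip_map X n (T_map (shift_map (eta_map X)) n e)) = [:: e].
  rewrite -[unzip_map X n _]/(spread _ n (T_map (branches X) n
    (T_map (shift_map (eta_map X)) n e))) T_map_comp E spread_collect.
  by congr [:: _]; exact: IH.
elim: (branches X n c) => [|e s IHs] //=.
by rewrite -[in RHS]IHs; apply: (congr1 (cat^~ _)) (E' e).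
Qed.

(** * Powers of a globular set, and compatibility of the multiplication with lists *)

Section Power.
Variables (m : nat) (Y : gset).

Lemma gtuple_src_src n (s : m.-tuple (Y n.+2)) :
  map_tuple src (map_tuple src s) = map_tuple src (map_tuple tgt s).
Proof. by apply: val_inj; exact: glist_src_src. Qed.

Lemma gtuple_tgt_src n (s : m.-tuple (Y n.+2)) :
  map_tuple tgt (map_tuple src s) = map_tuple tgt (map_tuple tgt s).
Proof. by apply: val_inj; exact: glist_tgt_src. Qed.

(** The summand of [glist Y] formed by the lists of length [m]; the inclusion is [collect] of the
    projections. *)
Definition gtuple : gset :=
  @GSet (fun n => m.-tuple (Y n)) (fun n s => map_tuple src s)
    (fun n s => map_tuple tgt s) gtuple_src_src gtuple_tgt_src.

Definition gtuple_proj (i : 'I_m) : gmap gtuple Y :=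
  @GMap gtuple Y (fun n s => tnth s i)
    (fun n s => tnth_map src s i) (fun n s => tnth_map tgt s i).

Lemma collect_gtuple_proj n (s : gtuple n) :
  collect (map gtuple_proj (enum 'I_m)) n s = s.
Proof. by rewrite /= /collect_fun -map_comp map_tnth_enum. Qed.

End Power.

Lemma T_map_inj (X Y : gset) (h : gmap X Y) :
  (forall n, injective (h n)) -> forall n, injective (T_map h n).
Proof.
move=> inj n [p f] [p' f'] E; have ep : p = p' := congr1 (@projT1 _ _) E.
subst p'; congr (existT _ p _); apply: gmap_eq => k z; apply: inj.
exact: (congr1 (fun g : gmap (tree p) Y => g k z) (existT_injr E)).
Qed.

Lemma T_map_image (X Y : gset) (h : gmap X Y) n (c : T_ob Y n) :
  (forall k, injective (h k)) ->
  (forall k (z : tree (tag c) k), exists x, h k x = tagged c k z) ->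
  exists c', T_map h n c' = c.
Proof.
case: c => p f /= inj /(gmap_lift inj) [f' ->].
by exists (existT (fun p => gmap (tree p) X) p f').
Qed.

Lemma size_base_spread (Y : gset) n (c : T_ob (glist Y) n) :
  size (base c) = size (spread Y n c).
Proof. by rewrite -base_spread size_map. Qed.

(** All lists labelling [f k c] have the same length, and this length does not vary with [c] since
    the tree is connected. So [f] lands in T of a single power of [Y]. *)
Lemma T_glist_factor n (p : Tr n) (Y : gset)
  (f : gmap (tree p) (T_ob (glist Y))) :
  exists (P : gset) (F : seq (gmap P Y)) (f' : gmap (tree p) (T_ob P)),
    f = gcomp (T_map (collect F)) f'.
Proof.
pose m := size (base (f 0 (root p))).
have sz k c : size (base (f k c)) = m.
  apply: (tree_connected (phi := fun k c => size (base (f k c)))) => {}k {}c.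
    by rewrite gsrc base_src.
  by rewrite gtgt !size_base_spread gtgt size_map.
pose F := map (@gtuple_proj m Y) (enum 'I_m).
have injF k : injective (collect F k).
  by move=> s t; rewrite !collect_gtuple_proj => /val_inj.
exists (gtuple m Y), F; apply: gmap_lift; first exact: T_map_inj.
move=> k c; apply: T_map_image => // l z.
have /eqP szm : size (tagged (f k c) l z) = m.
  rewrite -(sz k c); case: (f k c) z => q g z; have [G ->] := collect_surj g.
  by rewrite /base /= /collect_fun !size_map.
by exists (Tuple szm); rewrite collect_gtuple_proj.
Qed.

(** By [T_glist_factor] the cell comes from one over some [P] along a finite list of maps to [Y];
    the claim becomes naturality of [mu_cell] for each of these maps. *)
Lemma spread_mu (Y : gset) n (c : T_ob (T_ob (glist Y)) n) :
  spread Y n (mu_cell c) =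
  map (@mu_cell Y n) (spread _ n (T_map (spread Y) n c)).
Proof.
case: c => p f; have [P [F [f' ->]]] := T_glist_factor f.
pose c' : T_ob (T_ob P) n := existT _ p f'.
rewrite -[existT _ _ _]/(T_map (T_map (collect F)) n c') mu_nat spread_collect.
have -> : T_map (spread Y) n (T_map (T_map (collect F)) n c') =
    T_map (collect (map (@T_map P Y) F)) n c'.
  rewrite T_map_comp; congr (T_map _ n c'); apply: gmap_eq => k d.
  by rewrite /= /collect_fun -map_comp; exact: spread_collect.
rewrite spread_collect -map_comp -[RHS]map_comp; apply: eq_map => g.
exact/esym/mu_nat.
Qed.

Lemma flatten_map_bind (A B C : Type) (F : B -> seq C) (G : A -> seq B)
  (h : A -> B) (s : seq A) : (forall a, flatten (map F (G a)) = F (h a)) ->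
  flatten (map F (flatten (map G s))) = flatten (map F (map h s)).
Proof.
by move=> E; elim: s => //= a s IH; rewrite map_cat flatten_cat E IH.
Qed.

Lemma mu_mu n (X : gset) (c : T_ob (T_ob (T_ob X)) n) :
  mu_cell (mu_cell c) = mu_cell (T_map (mu_map X) n c).
Proof.
elim: n X c => [|n IH] X c.
  by apply: base_inj; rewrite !base_mu.
apply: T_cell_inj; first by rewrite !base_mu -base_mu.
rewrite !mu_branches branches_nat.
(* The contribution of the branch [e] of [c] to both sides: unzip [e], unzip each factor again, then
   multiply twice. *)
pose K e := [seq mu_cell (mu_cell d) | d <-
  flatten [seq spread _ n (T_map (unzip_map X) n e')
          | e' <- unzip_map (T_ob X) n e]].
have L e : flatten [seq map (@mu_cell _ n) (unzip_map X n e')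
    | e' <- map (@mu_cell _ n) (unzip_map (T_ob X) n e)] = K e.
  rewrite /K; apply: map_flatten_square => e'.
  have -> : unzip_map X n (mu_cell e') =
      map (@mu_cell _ n) (spread _ n (T_map (unzip_map X) n e')).
    rewrite -[LHS]/(spread _ n (T_map (branches X) n (mu_cell e'))).
    by rewrite -mu_nat spread_mu T_map_comp.
  exact/esym/map_comp.
have R e : map (@mu_cell _ n) (unzip_map X n
    (T_map (shift_map (mu_map X)) n e)) = K e.
  (* The recursion [mu_branches] as an equation of maps, so that T can be applied to it. *)
  have E : gcomp (branches X) (shift_map (mu_map X)) =
      gcomp (glist_flatten _) (gcomp (glist_map
        (gcomp (glist_map (mu_map (shift X))) (unzip_map X)))
        (branches (T_ob X))).
    apply: gmap_eq => k d; apply: etrans (mu_branches d) _ => /=.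
    by congr flatten; rewrite -map_comp.
  have -> : unzip_map X n (T_map (shift_map (mu_map X)) n e) =
      map (T_map (mu_map (shift X)) n) (flatten
        [seq spread _ n (T_map (unzip_map X) n e')
        | e' <- unzip_map (T_ob X) n e]).
    rewrite -[LHS]/(spread _ n (T_map (branches X) n
      (T_map (shift_map (mu_map X)) n e))).
    rewrite T_map_comp E -!T_map_comp spread_flatten spread_nat.
    apply: map_flatten_square => e'.
    by rewrite -T_map_comp spread_nat.
  by rewrite -[LHS]map_comp; apply: eq_map => d; exact/esym/IH.
by apply: flatten_map_bind => e; rewrite R; exact: L.
Qed.

(** * The multiplication is cartesian *)

Lemma cat_inj (A : Type) (s1 s2 t1 t2 : seq A) :
  size s1 = size s2 -> s1 ++ t1 = s2 ++ t2 -> s1 = s2 /\ t1 = t2.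
Proof.
move=> sz E; split.
  by have := congr1 (take (size s1)) E; rewrite take_size_cat // take_size_cat.
by have := congr1 (drop (size s1)) E; rewrite drop_size_cat // drop_size_cat.
Qed.

Lemma cons_inj (A : Type) (a b : A) (s t : seq A) :
  a :: s = b :: t -> a = b /\ s = t.
Proof. by case. Qed.

Lemma map_eq_cat (A B : Type) (f : A -> B) (t : seq A) (a b : seq B) :
  a ++ b = map f t ->
  exists t1 t2, [/\ t = t1 ++ t2, a = map f t1 & b = map f t2].
Proof.
move=> E; exists (take (size a) t), (drop (size a) t); split.
- by rewrite cat_take_drop.
- by rewrite map_take -E take_size_cat.
- by rewrite map_drop -E drop_size_cat.
Qed.

Lemma map_inj2 (A B C : Type) (f : A -> B) (g : A -> C) (s t : seq A) :
  (forall a b, f a = f b -> g a = g b -> a = b) ->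
  map f s = map f t -> map g s = map g t -> s = t.
Proof.
move=> inj; elim: s t => [|a s IH] [|b t] //= [ef efs] [eg egs].
by rewrite (inj a b) // (IH t).
Qed.

Lemma map_lift2 (A B C D : Type) (f : A -> B) (g : A -> C) (u : B -> D)
  (v : C -> D) (s : seq B) (t : seq C) :
  (forall b c, u b = v c -> exists a, f a = b /\ g a = c) ->
  map u s = map v t -> exists w, map f w = s /\ map g w = t.
Proof.
move=> lift; elim: s t => [|b s IH] [|c t] //=; first by exists [::].
move=> [/lift [a [fa ga]] /IH [w [fw gw]]]; exists (a :: w).
by rewrite /= fa ga fw gw.
Qed.

Section TreeBranches.
Variables (X : gset) (n : nat) (p : Tr n).

(** In the shift every target comes from a cell of dimension at least 2, so both faces preserve
    [base] and connectedness applies. *)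
Lemma base_shift (f : gmap (tree p) (shift (T_ob X))) k (z : tree p k) :
  base (f k z : T_ob X k.+1) = base (f 0 (root p) : T_ob X 1).
Proof.
apply: (tree_connected (phi := fun k z => base (f k z : T_ob X k.+1)))
  => {}k {}z.
  by rewrite gsrc; exact: base_src.
by rewrite gtgt; exact: base_tgt.
Qed.

Lemma branches_monic (f g : gmap (tree p) (shift (T_ob X))) :
  gcomp (branches X) f = gcomp (branches X) g ->
  base (f 0 (root p) : T_ob X 1) = base (g 0 (root p) : T_ob X 1) -> f = g.
Proof.
move=> E eb; apply: gmap_eq => k z; apply: T_cell_inj.
  by rewrite !base_shift.
exact: (congr1 (fun h : gmap _ _ => h k z) E).
Qed.

(** The ends of [g k z] are constant along the tree, and at the root they are the ends of the
    multiplied cell. *)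
Lemma zigzag_collect (x : X 0) (F : seq (gmap (tree p) (T_ob (shift X)))) :
  zigzag x [seq mu_cell (existT (fun p => gmap (tree p) _) p g) | g <- F] ->
  forall k (z : tree p k), zigzag x (collect F k z).
Proof.
elim: F x => [|g F IH] x //= [<- zz] k z; rewrite /= -/(collect_fun F z).
have -> : beg (g k z) = beg (g 0 (root p)).
  apply: (tree_connected (phi := fun k z => beg (g k z))) => {}k {}z.
    by rewrite gsrc beg_src.
  by rewrite gtgt beg_tgt.
have -> : fin (g k z) = fin (g 0 (root p)).
  apply: (tree_connected (phi := fun k z => fin (g k z))) => {}k {}z.
    by rewrite gsrc fin_src.
  by rewrite gtgt fin_tgt.
split; first by rewrite /beg base_mu.
by apply: IH; rewrite /fin base_mu in zz.
Qed.

(** Cells with base [x] and the prescribed branches exist by [T_cell_surj]; they commute with faces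
    because base and branches determine a cell. *)
Lemma branches_lift (x : X 0) (F : seq (gmap (tree p) (T_ob (shift X)))) :
  (forall k (z : tree p k), zigzag x (collect F k z)) ->
  exists f : gmap (tree p) (shift (T_ob X)),
    gcomp (branches X) f = collect F /\
    base (f 0 (root p) : T_ob X 1) = x.
Proof.
move=> zz.
pose f k (z : tree p k) : T_ob X k.+1 := sval (cid (T_cell_surj (zz k z))).
have fE k z : base (f k z) = x /\ branches X k (f k z) = collect F k z.
  by rewrite /f; case: cid.
have fs k (z : tree p k.+1) : f k (src z) = src (f k.+1 z).
  apply: T_cell_inj; first by rewrite base_src !(proj1 (fE _ _)).
  rewrite (proj2 (fE _ _)) gsrc -(proj2 (fE _ _)).
  exact/esym/(gsrc (branches X) (f k.+1 z : shift (T_ob X) k.+1)).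
have ft k (z : tree p k.+1) : f k (tgt z) = tgt (f k.+1 z).
  apply: T_cell_inj; first by rewrite base_tgt !(proj1 (fE _ _)).
  rewrite (proj2 (fE _ _)) gtgt -(proj2 (fE _ _)).
  exact/esym/(gtgt (branches X) (f k.+1 z : shift (T_ob X) k.+1)).
exists (@GMap (tree p) (shift (T_ob X)) f fs ft); split.
  by apply: gmap_eq => k z; exact: (proj2 (fE k z)).
exact: (proj1 (fE _ _)).
Qed.

End TreeBranches.

Section Cartesian.
Variables (X Y : gset) (h : gmap X Y).

Lemma unzip_inj n (e e' : T_ob (shift (T_ob X)) n) :
  tag e = tag e' -> base (base e : T_ob X 1) = base (base e' : T_ob X 1) ->
  unzip_map X n e = unzip_map X n e' -> e = e'.
Proof.
case: e e' => p f [p' f'] /= ep; subst p' => eb E.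
congr (existT _ p _); apply: branches_monic => //.
exact: existT_injr (spread_inj
  (c := T_map (branches X) n (existT _ p f))
  (c' := T_map (branches X) n (existT _ p f')) erefl E).
Qed.

(** [T_map] preserves shapes, so all members of [w] have the shape of [e] and form a list of maps
    from one tree; the zigzag condition joins them into a single branch. *)
Lemma unzip_lift n (e : T_ob (shift (T_ob Y)) n)
  (w : seq (T_ob (T_ob (shift X)) n)) (x : X 0) :
  map (T_map (T_map (shift_map h)) n) w = unzip_map Y n e ->
  zigzag x (map (@mu_cell _ n) w) -> base (base e : T_ob Y 1) = h 0 x ->
  exists e' : T_ob (shift (T_ob X)) n,
    [/\ T_map (shift_map (T_map h)) n e' = e, base (base e' : T_ob X 1) = x
      & unzip_map X n e' = w].
Proof.
case: e => p f; have [F EF] := collect_surj (gcomp (branches Y) f).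
rewrite [unzip_map _ _ _]/(spread _ n (existT _ p (gcomp (branches Y) f))).
rewrite /= EF spread_funE => Ew zz eb.
have [F' Ew' EF'] : exists2 F',
    w = map (existT (fun p => gmap (tree p) (T_ob (shift X))) p) F' &
    F = map (gcomp (T_map (shift_map h))) F'.
  clear zz eb EF; elim: w F Ew => [|[q g] w IH] [|g' F] //= E.
    by exists [::].
  have E0 := congr1 (head (existT _ p g')) E.
  have eq : q = p := congr1 (@projT1 _ _) E0.
  subst q; have {}E0 := existT_injr E0.
  have [F' -> ->] := IH F (congr1 behead E).
  by exists (g :: F'); rewrite //= -E0.
subst w; move: zz; rewrite -map_comp.
move=> /zigzag_collect /branches_lift [f' [Ef' bf']].
exists (existT _ p f'); split=> //.
  congr (existT _ p _); apply: branches_monic.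
    rewrite EF EF' -gcomp_glist_map_collect -Ef' !gcompA; congr gcomp.
    exact: gcomp_branches.
  by rewrite -[LHS]/(h 0 (base (f' 0 (root p) : T_ob X 1))) bf'.
rewrite -[LHS]/(spread _ n (existT _ p (gcomp (branches X) f'))) Ef'.
exact: spread_funE.
Qed.

End Cartesian.

Lemma size_unzip (X Y : gset) (h : gmap X Y) n
  (e e' : T_ob (shift (T_ob X)) n) :
  T_map (shift_map (T_map h)) n e = T_map (shift_map (T_map h)) n e' ->
  size (unzip_map X n e) = size (unzip_map X n e').
Proof.
move=> E; have := congr1 (fun e => size (unzip_map Y n e)) E.
by rewrite !unzip_nat (size_map _ (unzip_map X n e)) size_map.
Qed.

(** Branches are compared from left to right. Their images under [h] fix the lengths of the blocks,
    so the equal concatenations split at the same places, and the zigzag supplies the common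
    starting vertex that [unzip_inj] requires. *)
Lemma mu_inj n (X Y : gset) (h : gmap X Y) (c c' : T_ob (T_ob X) n) :
  T_map (T_map h) n c = T_map (T_map h) n c' -> mu_cell c = mu_cell c' ->
  c = c'.
Proof.
elim: n X Y h c c' => [|n IH] X Y h c c' ET Em.
  by apply/base_inj/base_inj; rewrite -!base_mu Em.
have eb : base c = base c' by apply: base_inj; rewrite -!base_mu Em.
apply: T_cell_inj => //.
have := zigzag_branches c; have := zigzag_branches c'; rewrite -eb.
have := congr1 (branches (T_ob Y) n) ET; rewrite !branches_nat.
have := congr1 (branches X n) Em; rewrite !mu_branches.
move: (branches _ n c) (branches _ n c') (base c) => s s' y.
elim: s s' y => [|e s IHs] [|e' s'] y //.
move=> Ef E [ey' zs'] [ey zs]; have [Ee Es] := cons_inj E.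
have [Ee1 Es1] : map (@mu_cell _ n) (unzip_map X n e) =
    map (@mu_cell _ n) (unzip_map X n e') /\
    flatten [seq map (@mu_cell _ n) (unzip_map X n e) | e <- s] =
    flatten [seq map (@mu_cell _ n) (unzip_map X n e) | e <- s'].
  apply: cat_inj Ef; rewrite (size_map _ (unzip_map X n e)).
  by rewrite (size_map _ (unzip_map X n e')) (size_unzip Ee).
have ee : e = e'.
  apply: unzip_inj; first exact: (congr1 (@projT1 _ _) Ee).
    by move: ey'; rewrite -ey /beg => /(congr1 (@base X 0)); rewrite !base_src.
  apply: (map_inj2 (g := T_map (T_map (shift_map h)) n)) Ee1 _.
    by move=> a b E1 E2; exact: IH E2 E1.
  by have := congr1 (unzip_map Y n) Ee; rewrite !unzip_nat.
rewrite -ee in zs' *; congr cons; exact: IHs Es1 Es zs' zs.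
Qed.

Lemma zigzag_end_map (X Y : gset) (h : gmap X Y) n (x : X 0)
  (s : seq (T_ob (shift X) n)) :
  zigzag_end (h 0 x) (map (T_map (shift_map h) n) s) = h 0 (zigzag_end x s).
Proof.
rewrite /zigzag_end -[RHS]last_map -!map_comp; congr (last _ _).
by apply: eq_map => c; exact/esym/gtgt.
Qed.

(** The branches of [c] cut those of [d] into consecutive blocks. Each block lifts factor by factor
    by induction, and [unzip_lift] turns it into a branch that starts where the previous block
    ended. *)
Lemma mu_lift n (X Y : gset) (h : gmap X Y) (d : T_ob X n)
  (c : T_ob (T_ob Y) n) :
  mu_cell c = T_map h n d ->
  exists c', T_map (T_map h) n c' = c /\ mu_cell c' = d.
Proof.
elim: n X Y h d c => [|n IH] X Y h d c E.
  exists (pt (pt (base d))); split; last exact: base_inj.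
  apply/base_inj/base_inj; rewrite -[RHS]base_mu E.
  by [].
have eb : base (base c) = h 0 (base d) by rewrite -base_mu E.
have := congr1 (branches Y n) E; rewrite branches_nat mu_branches.
have := zigzag_branches c; have := zigzag_branches d.
move Es : (branches _ n c) => s; move Et : (branches X n d) => t.
move Ex : (base d) eb => x; move Ey : (base c) => y eb zt zs Ef.
suff [s' [zs' Es' Et']] : exists s', [/\ zigzag (pt x) s',
    map (T_map (shift_map (T_map h)) n) s' = s &
    flatten [seq map (@mu_cell _ n) (unzip_map X n e) | e <- s'] = t].
  have [c' [bc' brc']] := T_cell_surj zs'.
  exists c'; split.
    apply: T_cell_inj; last by rewrite branches_nat brc' Es' Es.
    by apply: base_inj; rewrite Ey eb base_map bc'.
  apply: T_cell_inj; first by rewrite base_mu bc' Ex.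
  by rewrite mu_branches brc' Et' Et.
clear Es Et Ex Ey E c d.
elim: s t x y eb zt zs Ef => [|e s IHs] t x y eb zt.
  by case: t zt => // _ _ _; exists [::].
move=> [ey zs] /map_eq_cat [t1 [t2 [Et Ee Es]]].
move: zt; rewrite Et => /zigzag_cat [zt1 zt2].
have [w [Ew Ew1]] := map_lift2 (fun b c => IH _ _ (shift_map h) c b) Ee.
have ebe : base (base e : T_ob Y 1) = h 0 x.
  by rewrite -eb -ey /beg base_src.
rewrite -Ew1 in zt1.
have [e' [Ee' be' ue']] := unzip_lift Ew zt1 ebe.
(* The end of the block just lifted is the starting vertex for the remaining branches. *)
have bf : base (fin e) = h 0 (zigzag_end x t1).
  by rewrite fin_base_mu ebe Ee zigzag_end_map.
have [s' [zs' Es' Ef']] := IHs _ _ _ bf zt2 zs Es.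
exists (e' :: s'); split.
- split; first by apply: base_inj; rewrite /beg base_src be'.
  suff -> : fin e' = pt (zigzag_end x t1) by [].
  by apply: base_inj; rewrite fin_base_mu be' ue' Ew1.
- by rewrite -Es' -Ee'.
- by rewrite -Ef' -Ew1 -ue'.
Qed.

(** * The left adjoint *)

(** Universal arrows are fixed by choice; functoriality, naturality of the counit and one triangle
    identity follow from uniqueness of extensions. *)
Lemma left_adjoint_of_universal (C D : category) (R : functor C D) :
  (forall d : D, exists (c : C) (u : hom d (R c)),
    forall (c' : C) (f : hom d (R c')),
      exists! g : hom c c', compm (fmap R g) u = f) ->
  has_left_adjoint R.
Proof.
move=> univ.
have {}univ d : exists z : {c : C & hom d (R c)}, forall c (f : hom d (R c)),
    exists! g : hom (tag z) c, compm (fmap R g) (tagged z) = f.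
  by have [c [u cu]] := univ d; exists (existT _ c u).
pose L0 d := tag (sval (cid (univ d))).
pose u d : hom d (R (L0 d)) := tagged (sval (cid (univ d))).
have uP d c (f : hom d (R c)) :
    exists! g : hom (L0 d) c, compm (fmap R g) (u d) = f.
  by rewrite /u /L0; case: cid.
pose ext d c (f : hom d (R c)) : hom (L0 d) c := sval (cid (uP d c f)).
have extE d c (f : hom d (R c)) : compm (fmap R (ext d c f)) (u d) = f.
  by rewrite /ext; case: cid => g [].
have inj d c (g g' : hom (L0 d) c) :
    compm (fmap R g) (u d) = compm (fmap R g') (u d) -> g = g'.
  move=> E; have [k [_ ku]] := uP d c (compm (fmap R g') (u d)).
  by rewrite -(ku g E) (ku g').
pose L1 a b (f : hom a b) : hom (L0 a) (L0 b) := ext _ _ (compm (u b) f).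
have L1E a b (f : hom a b) : compm (fmap R (L1 _ _ f)) (u a) = compm (u b) f.
  exact: extE.
have L11 a : L1 _ _ (idm a) = idm (L0 a).
  by apply: inj; rewrite L1E fmap1 comp1m compm1.
have L1M a b c (g : hom b c) (f : hom a b) :
    L1 _ _ (compm g f) = compm (L1 _ _ g) (L1 _ _ f).
  by apply: inj; rewrite L1E fmapM -[RHS]compA L1E [RHS]compA L1E compA.
pose L := Functor L11 L1M.
pose unit := @NatTrans _ _ (functor_id D) (functor_comp R L) u L1E.
pose eps c : hom (L (R c)) c := ext _ _ (idm (R c)).
have epsE c : compm (fmap R (eps c)) (u (R c)) = idm (R c) by exact: extE.
have eps_nat a b (f : hom a b) :
    compm (fmap (functor_id C) f) (eps a) =
    compm (eps b) (fmap (functor_comp L R) f).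
  apply: inj; rewrite /= !fmapM -!compA L1E epsE compm1 compA.
  by rewrite epsE comp1m.
pose counit := @NatTrans _ _ (functor_comp L R) (functor_id C) eps eps_nat.
exists L, unit, counit; split=> [d|c]; last exact: epsE.
by apply: inj; rewrite fmap1 comp1m fmapM -compA L1E compA epsE comp1m.
Qed.

Section Quotient.
Variables (P : Type) (R : P -> P -> Prop).

(* The equivalence relation generated by R, encoded by the R-saturated
   predicates. *)
Definition eqv (x y : P) : Prop :=
  forall phi : P -> Prop, (forall a b, R a b -> phi a <-> phi b) ->
    phi x <-> phi y.

Definition quot : Type := {S : P -> Prop | exists x, S = eqv x}.

Definition cls (x : P) : quot := exist _ (eqv x) (ex_intro _ x erefl).

Lemma cls_surj (q : quot) : exists x, q = cls x.
Proof. by case: q => S [x E]; exists x; exact: eq_exist. Qed.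

Lemma cls_eq x y : R x y -> cls x = cls y.
Proof.
move=> Rxy; apply: eq_exist; apply/funext => z; apply/propext.
split=> H phi inv.
  by rewrite -(inv _ _ Rxy); exact: H.
by rewrite (inv _ _ Rxy); exact: H.
Qed.

Variables (W : Type) (f : P -> W).
Hypothesis f_inv : forall a b, R a b -> f a = f b.

Definition quot_lift (q : quot) : W := f (sval (cid (svalP q))).

Lemma quot_liftE x : quot_lift (cls x) = f x.
Proof.
rewrite /quot_lift; case: cid => y /= E.
have : eqv x y by rewrite E => phi.
(* Invariance of [f] makes this predicate saturated, so it cannot separate [x] from the chosen
   representative [y]. *)
move/(_ (fun z => f z = f y)) => H; apply/esym.
by apply/H => // a b /f_inv ->.
Qed.

End Quotient.

(* The value at (B, beta) of the left adjoint of the functor induced by T on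
   the slice over A: the colimit, over the cells b of B, of the trees that are
   the shapes of the beta b. *)
Section LeftAdjoint.
Variables (A B : gset) (beta : gmap B (T_ob A)).

(* The redundant field [shape] makes the gluing relation cast-free. *)
Record shape_point (n : nat) := ShapePoint {
  dim : nat;
  elt : B dim;
  shape : T_ob A dim;
  shapeE : beta dim elt = shape;
  point : tree (tag shape) n }.

Lemma shape_src k (b : B k.+1) c : beta k.+1 b = c -> beta k (src b) = src c.
Proof. by move=> <-; exact: gsrc. Qed.

Lemma shape_tgt k (b : B k.+1) c : beta k.+1 b = c -> beta k (tgt b) = tgt c.
Proof. by move=> <-; exact: gtgt. Qed.

(** Generating identifications of the colimit over the category of elements of [B]: the tree of a
    face of [b] is glued to the matching boundary of the tree of [b]. *)
Inductive glue n : shape_point n -> shape_point n -> Prop :=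
| glue_src k (b : B k.+1) c (e : beta k.+1 b = c)
    (z : tree (bd (tag c)) n) :
    glue (@ShapePoint n k (src b) (src c) (shape_src e) z)
         (ShapePoint e (sigma (tag c) n z))
| glue_tgt k (b : B k.+1) c (e : beta k.+1 b = c)
    (z : tree (bd (tag c)) n) :
    glue (@ShapePoint n k (tgt b) (tgt c) (shape_tgt e) z)
         (ShapePoint e (tau (tag c) n z)).

Definition point_src n (x : shape_point n.+1) : shape_point n :=
  ShapePoint (shapeE x) (src (point x)).

Definition point_tgt n (x : shape_point n.+1) : shape_point n :=
  ShapePoint (shapeE x) (tgt (point x)).

Lemma glue_point_src n (x y : shape_point n.+1) :
  glue x y -> cls (@glue n) (point_src x) = cls (@glue n) (point_src y).
Proof.
case=> k b c e z; apply: cls_eq.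
  by have := glue_src e (src z); rewrite (gsrc (sigma (tag c))).
by have := glue_tgt e (src z); rewrite (gsrc (tau (tag c))).
Qed.

Lemma glue_point_tgt n (x y : shape_point n.+1) :
  glue x y -> cls (@glue n) (point_tgt x) = cls (@glue n) (point_tgt y).
Proof.
case=> k b c e z; apply: cls_eq.
  by have := glue_src e (tgt z); rewrite (gtgt (sigma (tag c))).
by have := glue_tgt e (tgt z); rewrite (gtgt (tau (tag c))).
Qed.

Definition colim_src n : quot (@glue n.+1) -> quot (@glue n) :=
  quot_lift (fun x => cls (@glue n) (point_src x)).

Definition colim_tgt n : quot (@glue n.+1) -> quot (@glue n) :=
  quot_lift (fun x => cls (@glue n) (point_tgt x)).

Lemma colim_srcE n (x : shape_point n.+1) :
  colim_src (cls (@glue _) x) = cls (@glue n) (point_src x).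
Proof. exact: quot_liftE (@glue_point_src n) x. Qed.

Lemma colim_tgtE n (x : shape_point n.+1) :
  colim_tgt (cls (@glue _) x) = cls (@glue n) (point_tgt x).
Proof. exact: quot_liftE (@glue_point_tgt n) x. Qed.

Lemma colim_src_src n (q : quot (@glue n.+2)) :
  colim_src (colim_src q) = colim_src (colim_tgt q).
Proof.
have [x ->] := cls_surj q; rewrite colim_srcE colim_tgtE !colim_srcE.
by rewrite /point_src /= src_src.
Qed.

Lemma colim_tgt_src n (q : quot (@glue n.+2)) :
  colim_tgt (colim_src q) = colim_tgt (colim_tgt q).
Proof.
have [x ->] := cls_surj q; rewrite colim_srcE colim_tgtE !colim_tgtE.
by rewrite /point_tgt /= tgt_src.
Qed.

Definition colim : gset :=
  @GSet (fun n => quot (@glue n)) colim_src colim_tgt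
    colim_src_src colim_tgt_src.

Definition colim_incl k (b : B k) c (e : beta k b = c) :
    gmap (tree (tag c)) colim :=
  @GMap (tree (tag c)) colim (fun n z => cls (@glue n) (ShapePoint e z))
    (fun n z => esym (colim_srcE (ShapePoint e z)))
    (fun n z => esym (colim_tgtE (ShapePoint e z))).

Lemma colim_ind n (Q : colim n -> Prop) :
  (forall k (b : B k) (z : tree (tag (beta k b)) n),
     Q (colim_incl (erefl (beta k b)) n z)) -> forall q, Q q.
Proof.
by move=> H q; have [[k b c e z] ->] := cls_surj q; subst c; exact: H.
Qed.

Definition colim_unit_fun k (b : B k) : T_ob colim k :=
  existT (fun p => gmap (tree p) colim) _ (colim_incl (erefl (beta k b))).

Lemma colim_unit_funE k (b : B k) c (e : beta k b = c) :
  colim_unit_fun b = existT _ (tag c) (colim_incl e).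
Proof. by subst c. Qed.

Lemma colim_unit_src k (b : B k.+1) :
  colim_unit_fun (src b) = src (colim_unit_fun b).
Proof.
rewrite (colim_unit_funE (shape_src erefl)); congr (existT _ _ _).
by apply: gmap_eq => n z; apply: cls_eq; constructor.
Qed.

Lemma colim_unit_tgt k (b : B k.+1) :
  colim_unit_fun (tgt b) = tgt (colim_unit_fun b).
Proof.
rewrite (colim_unit_funE (shape_tgt erefl)); congr (existT _ _ _).
by apply: gmap_eq => n z; apply: cls_eq; constructor.
Qed.

Definition colim_unit : gmap B (T_ob colim) :=
  @GMap B (T_ob colim) (@colim_unit_fun) (@colim_unit_src) (@colim_unit_tgt).

Section Descent.
Variables (X : gset) (phi : forall k (b : B k) c, beta k b = c ->
  gmap (tree (tag c)) X).
Hypothesis phi_src : forall k (b : B k.+1) c (e : beta k.+1 b = c),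
  phi (c := src c) (shape_src e) = gcomp (phi e) (sigma (tag c)).
Hypothesis phi_tgt : forall k (b : B k.+1) c (e : beta k.+1 b = c),
  phi (c := tgt c) (shape_tgt e) = gcomp (phi e) (tau (tag c)).

Definition descent_point n (x : shape_point n) : X n :=
  phi (shapeE x) n (point x).

Lemma descent_glue n (x y : shape_point n) :
  glue x y -> descent_point x = descent_point y.
Proof.
case=> k b c e z; rewrite /descent_point /=.
  by rewrite phi_src.
by rewrite phi_tgt.
Qed.

Definition descent_fun n : colim n -> X n := quot_lift (@descent_point n).

Lemma descent_funE k (b : B k) c (e : beta k b = c) n (z : tree (tag c) n) :
  descent_fun (colim_incl e n z) = phi e n z.
Proof. exact: quot_liftE (@descent_glue n) _. Qed.

Lemma descent_src n (q : colim n.+1) :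
  descent_fun (src q) = src (descent_fun q).
Proof.
by elim/colim_ind: q => k b z; rewrite -gsrc !descent_funE gsrc.
Qed.

Lemma descent_tgt n (q : colim n.+1) :
  descent_fun (tgt q) = tgt (descent_fun q).
Proof.
by elim/colim_ind: q => k b z; rewrite -gtgt !descent_funE gtgt.
Qed.

Definition descent : gmap colim X := GMap descent_src descent_tgt.

Lemma descent_incl k (b : B k) c (e : beta k b = c) :
  gcomp descent (colim_incl e) = phi e.
Proof. by apply: gmap_eq => n z; exact: descent_funE. Qed.

End Descent.

Definition colim_arr : gmap colim A :=
  @descent A (fun k b c e => tagged c) (fun _ _ _ _ => erefl)
    (fun _ _ _ _ => erefl).

Lemma colim_arr_unit : gcomp (T_map colim_arr) colim_unit = beta.
Proof.
apply: gmap_eq => k b; rewrite /= /T_map_fun /= descent_incl.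
by case: (beta k b).
Qed.

(** Since T preserves shapes, [f k b] has the shape of [beta k b] and so is a map from that tree to
    [X] over [A]; compatibility of [f] with faces makes these maps a cocone. *)
Lemma colim_universal (X : gset) (x : gmap X A) (f : gmap B (T_ob X)) :
  gcomp (T_map x) f = beta ->
  exists g : gmap colim X, gcomp x g = colim_arr /\
    gcomp (T_map g) colim_unit = f.
Proof.
move=> fE.
have ex k (b : B k) c (e : beta k b = c) :
    exists g : gmap (tree (tag c)) X,
      existT (fun p => gmap (tree p) X) (tag c) g = f k b /\
      gcomp x g = tagged c.
  subst c; rewrite -fE /=; exists (tagged (f k b)); split=> //.
  by case: (f k b).
pose phi k (b : B k) c (e : beta k b = c) := sval (cid (ex k b c e)).
have phiE k (b : B k) c (e : beta k b = c) :
    existT (fun p => gmap (tree p) X) (tag c) (phi k b c e) = f k b /\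
    gcomp x (phi k b c e) = tagged c.
  by rewrite /phi; case: cid.
have phi_src k (b : B k.+1) c (e : beta k.+1 b = c) :
    phi k (src b) (src c) (shape_src e) =
    gcomp (phi k.+1 b c e) (sigma (tag c)).
  apply: (@existT_injr _ (fun p => gmap (tree p) X)).
  by rewrite (proj1 (phiE _ _ _ _)) gsrc -(proj1 (phiE _ _ _ e)).
have phi_tgt k (b : B k.+1) c (e : beta k.+1 b = c) :
    phi k (tgt b) (tgt c) (shape_tgt e) =
    gcomp (phi k.+1 b c e) (tau (tag c)).
  apply: (@existT_injr _ (fun p => gmap (tree p) X)).
  by rewrite (proj1 (phiE _ _ _ _)) gtgt -(proj1 (phiE _ _ _ e)).
exists (descent phi_src phi_tgt); split.
  apply: gmap_eq => n; elim/colim_ind => k b z.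
  rewrite /= !descent_funE //.
  exact: (congr1 (fun g : gmap _ _ => g n z) (proj2 (phiE k b _ erefl))).
apply: gmap_eq => k b; rewrite /= /T_map_fun /= descent_incl.
exact: (proj1 (phiE k b _ erefl)).
Qed.

(** The inclusions of the trees, which are the labels of the unit, jointly cover the colimit. *)
Lemma colim_unique (X : gset) (g g' : gmap colim X) :
  gcomp (T_map g) colim_unit = gcomp (T_map g') colim_unit -> g = g'.
Proof.
move=> E; apply: gmap_eq => n; elim/colim_ind => k b z.
have Eb := congr1 (fun h : gmap B (T_ob X) => h k b) E.
exact: (congr1 (fun h : gmap _ X => h n z)
  (existT_injr (F := fun p => gmap (tree p) X) Eb)).
Qed.

End LeftAdjoint.

Lemma T_pra : pra Tfun.
Proof.
move=> A; apply: left_adjoint_of_universal => -[B beta].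
pose u : @slice_hom Glob (T_ob A) (SliceOb B beta)
    (slice_functor Tfun A (@SliceOb Glob A (colim beta) (colim_arr beta))) :=
  @SliceHom Glob (T_ob A) (SliceOb B beta)
    (slice_functor Tfun A (@SliceOb Glob A (colim beta) (colim_arr beta)))
    (colim_unit beta) (colim_arr_unit beta).
exists (@SliceOb Glob A (colim beta) (colim_arr beta)), u.
move=> [X x] [f /= fE]; have [g [gE gu]] := colim_universal fE.
exists (@SliceHom Glob A (@SliceOb Glob A (colim beta) (colim_arr beta))
  (SliceOb X x) g gE); split; first exact: slice_hom_eq.
move=> [g' g'E] /(congr1 (@stop _ _ _ _)) /= g'u; apply: slice_hom_eq => /=.
by apply: colim_unique; rewrite gu g'u.
Qed.

(** * Unit and multiplication as cartesian transformations, and the monad *)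

Lemma eta_map_nat (X Y : gset) (h : gmap X Y) :
  gcomp (T_map h) (eta_map X) = gcomp (eta_map Y) h.
Proof. by apply: gmap_eq => n x; exact: eta_nat. Qed.

Lemma mu_map_nat (X Y : gset) (h : gmap X Y) :
  gcomp (T_map h) (mu_map X) = gcomp (mu_map Y) (T_map (T_map h)).
Proof. by apply: gmap_eq => n c; exact/esym/mu_nat. Qed.

Definition eta_trans : nat_trans (functor_id Glob) Tfun :=
  @NatTrans Glob Glob (functor_id Glob) Tfun eta_map eta_map_nat.

Definition mu_trans : nat_trans (functor_comp Tfun Tfun) Tfun :=
  @NatTrans Glob Glob (functor_comp Tfun Tfun) Tfun mu_map mu_map_nat.

(** A cell lying over a unit cell has the shape [globe n], hence is itself the unit at the label of
    its top cell. *)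
Lemma eta_cartesian : cartesian eta_trans.
Proof.
move=> X Y h; apply: pullback_of_cells; first exact: eta_map_nat.
move=> n [p f] y /= E.
have ep : p = globe n := congr1 (@projT1 _ _) E.
subst p; have {}E : gcomp h f = globe_map y := existT_injr E.
exists (f n (globe_top n)); split.
  split; first by congr existT; apply/esym/globe_mapP.
  exact: etrans (congr1 (fun g : gmap _ Y => g n (globe_top n)) E)
    (globe_map_top y).
move=> x [Ex _]; have <- : globe_map x = f := existT_injr Ex.
exact: globe_map_top.
Qed.

Lemma mu_cartesian : cartesian mu_trans.
Proof.
move=> X Y h; apply: pullback_of_cells; first exact: mu_map_nat.
move=> n d c E; have [c' [Tc' mc']] := mu_lift (esym E).
exists c'; split=> // c'' [mc'' Tc'']; apply: (mu_inj (h := h)).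
  by rewrite Tc'.
by rewrite mc'.
Qed.

Theorem proposition6p13 :
  exists (eta : nat_trans (functor_id Glob) Tfun)
         (mu : nat_trans (functor_comp Tfun Tfun) Tfun),
    (forall (X : gset) (n : nat) (x : X n),
       gfun (eta X) x = existT _ (globe n) (globe_map x)) /\
    (forall (X : gset) (n : nat) (p : Tr n) (f : gmap (tree p) (T_ob X)),
       gfun (mu X) (existT _ p f) = mult f) /\
    is_pra_monad eta mu.
Proof.
exists eta_trans, mu_trans; split=> //; split=> //.
split; [|exact: T_pra|exact: eta_cartesian|exact: mu_cartesian].
split=> X; apply: gmap_eq => n c /=.
- exact: mu_eta.
- exact: mu_T_eta.
- exact: mu_mu.
Qed.
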